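(* Let $\alpha\in(0,1)$, $\gamma,\varepsilon>0$, $\triangle t=T/N$ with $T>0$ and $N\in\mathbb{N}$, $N\ge1$, and $f(u)=u^3-u$. Let $S\ge2$ and $\|u^0\|_{L^\infty(\Omega)}\le1$, and let $(u^n)_{0\le n\le N}$ satisfy the semidiscrete L1 implicit-explicit scheme $$\overline\partial_t^\alpha u^n=\gamma\big(\varepsilon^2\Delta u^n-f(u^{n-1})-S(u^n-u^{n-1})\big)\ \text{ in }\Omega,\qquad 1\le n\le N,$$ with homogeneous Dirichlet boundary condition, where $$\overline\partial_t^\alpha u^n=\sum_{k=1}^n b_{n-k}(u^k-u^{k-1}),\qquad b_k=\frac{(k+1)^{1-\alpha}-k^{1-\alpha}}{\Gamma(2-\alpha)\,\triangle t^\alpha}.$$ Then the scheme is unconditionally energy stable (no restriction on $\triangle t$), in the sense that the modified energy dissipation law $$\tilde E(u^n)\le\tilde E(u^{n-1}),\qquad 1\le n\le N,$$ holds, where $\tilde E(u^0)=E(u^0)$ and, for $n\ge1$, $$\tilde E(u^n)=E(u^n)+\frac1{2\gamma}\sum_{k=1}^{n-1}(b_{n-k-1}-b_{n-k})\|u^n-u^k\|^2+\frac1{2\gamma}b_{n-1}\|u^n-u^0\|^2 .$$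
   Context: $\Omega\subset\mathbb{R}^d$ is a bounded domain with sufficiently regular boundary; $\|\cdot\|$ is the norm of $L^2(\Omega)$; $u^n\in H^2(\Omega)\cap H_0^1(\Omega)$ for all $n\ge 0$. The Ginzburg--Landau energy is $E(u)=\int_\Omega\big(\frac{\varepsilon^2}{2}|\nabla u|^2+F(u)\big)dx$ with $F(u)=\frac14(u^2-1)^2$, so that $F'=f$. Empty sums are zero. *)

(* Defs.v *)
From HB Require Import structures.
From mathcomp Require Import all_boot all_order all_algebra.
From mathcomp Require Import all_classical all_reals all_analysis.

Set Implicit Arguments.
Unset Strict Implicit.
Unset Printing Implicit Defensive.

Import Order.TTheory GRing.Theory Num.Theory.
Import numFieldNormedType.Exports.

Local Open Scope classical_set_scope.
Local Open Scope ring_scope.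

Definition rV_display : measure_display. Proof. exact. Qed.

Section measurable_rV.
Context {R : realType} {n : nat}.

Definition coord_rV (i : 'I_n) (x : 'rV[R]_n) : measurableTypeR R := x ord0 i.

Let rV_set0 : g_sigma_preimage coord_rV set0.
Proof. exact: sigma_algebra0. Qed.

Let rV_setC A : g_sigma_preimage coord_rV A -> g_sigma_preimage coord_rV (~` A).
Proof. exact: sigma_algebraC. Qed.

Let rV_bigcup (F : (set 'rV[R]_n)^nat) :
  (forall i, g_sigma_preimage coord_rV (F i)) ->
  g_sigma_preimage coord_rV (\bigcup_i F i).
Proof. exact: sigma_algebra_bigcup. Qed.

(* The sigma-algebra generated by the coordinates, i.e. the Borel one. *)
HB.instance Definition _ := @isMeasurable.Build rV_display 'rV[R]_n
  (g_sigma_preimage coord_rV) rV_set0 rV_setC rV_bigcup.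

Lemma measurable_coord_rV (i : 'I_n) : measurable_fun setT (coord_rV i).
Proof.
move=> _ Y mY; rewrite setTI; apply: sub_sigma_algebra => /=.
rewrite -bigcup_seq/=; exists i => /=; first by rewrite mem_index_enum.
by exists Y => //; rewrite setTI.
Qed.

Lemma measurable_fun_rVP d (T : measurableType d) (f : T -> 'rV[R]_n) :
  (forall i, measurable_fun setT (coord_rV i \o f)) -> measurable_fun setT f.
Proof.
move=> mf _ A mA; rewrite setTI.
suff: g_sigma_preimage (fun i => coord_rV i \o f) `<=` measurable.
  by apply; rewrite g_sigma_preimage_comp; exists A => //; rewrite setTI.
apply: smallest_sub; first exact: sigma_algebra_measurable.
rewrite -bigcup_seq/=; apply: bigcup_sub => i _ B [C mC <-].
exact: mf.
Qed.

End measurable_rV.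

Section lebesgue_rV.
Context {R : realType}.

Definition rV_cons n (p : measurableTypeR R * 'rV[R]_n) : 'rV[R]_n.+1 :=
  row_mx (p.1 : R)%:M p.2.

Definition rV_uncons n (x : 'rV[R]_n.+1) : measurableTypeR R * 'rV[R]_n :=
  (x ord0 ord0, rsubmx (x : 'rV_(1 + n))).

Lemma rV_consK n : cancel (@rV_cons n) (@rV_uncons n).
Proof.
case=> a v; rewrite /rV_cons/rV_uncons; congr (_, _); last exact: row_mxKr.
transitivity (row_mx (a : R)%:M v ord0 (lshift n ord0)).
  by congr (row_mx _ _ _ _); exact/val_inj.
by rewrite (row_mxEl (a : R)%:M v) mxE eqxx mulr1n.
Qed.

Lemma rV_cons0 n p : @rV_cons n p ord0 ord0 = p.1.
Proof. by have /(congr1 fst) := rV_consK p. Qed.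

Lemma rV_consS n p (i : 'I_n) :
  @rV_cons n p ord0 (lift ord0 i) = p.2 ord0 i.
Proof.
rewrite -(row_mxEr (p.1 : R)%:M p.2 ord0 i).
by congr (row_mx _ _ _ _); exact/val_inj.
Qed.

Lemma measurable_rV_cons n : measurable_fun setT (@rV_cons n).
Proof.
apply: measurable_fun_rVP => i; case: (unliftP ord0 i) => [j|] ->.
  rewrite (_ : _ \o _ = coord_rV j \o snd); last first.
    by apply/funext => p /=; rewrite /coord_rV rV_consS.
  apply: measurableT_comp; [exact: measurable_coord_rV|exact: measurable_snd].
rewrite (_ : _ \o _ = fst); first exact: measurable_fst.
by apply/funext => p /=; rewrite /coord_rV rV_cons0.
Qed.

Lemma measurable_rV_uncons n : measurable_fun setT (@rV_uncons n).
Proof.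
apply: measurable_fun_pair; first exact: measurable_coord_rV.
apply: measurable_fun_rVP => i.
rewrite (_ : _ \o _ = coord_rV (rshift 1 i)); first exact: measurable_coord_rV.
by apply/funext => x /=; rewrite /coord_rV mxE.
Qed.

Section step.
Variables (n : nat) (nu : {sigma_finite_measure set 'rV[R]_n -> \bar R}).

Definition lebesgue_rV_step : set 'rV[R]_n.+1 -> \bar R :=
  pushforward (@lebesgue_measure R \x nu)%E (@rV_cons n).

Let mcons := @measurable_rV_cons n.

Let step0 : lebesgue_rV_step set0 = 0%E.
Proof. by rewrite /lebesgue_rV_step /pushforward preimage_set0 measure0. Qed.

Let step_ge0 A : (0 <= lebesgue_rV_step A)%E.
Proof. exact: measure_ge0. Qed.

Let step_sigma_additive : semi_sigma_additive lebesgue_rV_step.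
Proof. by apply: measure_semi_sigma_additive; exact: mcons. Qed.

HB.instance Definition _ := isMeasure.Build _ _ _ lebesgue_rV_step
  step0 step_ge0 step_sigma_additive.

Let step_sigma_finite : sigma_finite setT lebesgue_rV_step.
Proof.
have /sigma_finiteP[F [TF ndF Foo]] := sigma_finiteT (@lebesgue_measure R).
have /sigma_finiteP[G [TG ndG Goo]] := sigma_finiteT nu.
exists (fun k => @rV_uncons n @^-1` (F k `*` G k)).
  apply/esym/seteqP; split => // x _.
  have [i _ Fi] : (\bigcup_k F k) (rV_uncons x).1 by rewrite -TF.
  have [j _ Gj] : (\bigcup_k G k) (rV_uncons x).2 by rewrite -TG.
  exists (maxn i j) => //; split.
    by move: Fi; exact/subsetPset/ndF/leq_maxl.
  by move: Gj; exact/subsetPset/ndG/leq_maxr.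
move=> k; have [mF Fk] := Foo k; have [mG Gk] := Goo k; split.
  rewrite -[X in measurable X]setTI; apply: measurable_rV_uncons => //.
  exact: measurableX.
rewrite /lebesgue_rV_step /pushforward -comp_preimage.
rewrite (_ : _ \o _ = id); last by apply/funext => p; exact: rV_consK.
by rewrite preimage_id product_measure1E// lte_mul_pinfty// ge0_fin_numE.
Qed.

HB.instance Definition _ := Measure_isSigmaFinite.Build _ _ _ lebesgue_rV_step
  step_sigma_finite.

End step.

Fixpoint lebesgue_rV n : {sigma_finite_measure set 'rV[R]_n -> \bar R} :=
  match n with
  | 0 => \d_(0 : 'rV[R]_0)
  | m.+1 => lebesgue_rV_step (lebesgue_rV m)
  end.

Lemma lebesgue_rV_box n (A : 'I_n -> set (measurableTypeR R)) :
  (forall i, measurable (A i)) ->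
  lebesgue_rV n [set x | forall i, A i (x ord0 i)] =
  (\prod_(i < n) lebesgue_measure (A i))%E.
Proof.
elim: n A => [|n IH] A mA.
  by rewrite big_ord0 /= diracE mem_set// => -[].
rewrite big_ord_recl -IH// -product_measure1E//=; last first.
  rewrite [X in measurable X](_ : _ =
      \bigcap_(i in [set: 'I_n]) (coord_rV i @^-1` A (lift ord0 i))).
    apply: fin_bigcap_measurable => // i _.
    by rewrite -[X in measurable X]setTI; exact: measurable_coord_rV.
  by apply/seteqP; split => x /= h i *; exact: h.
rewrite /lebesgue_rV_step /pushforward; congr (_ _).
apply/seteqP; split => p /=.
  move=> h; split; first by have := h ord0; rewrite rV_cons0.
  by move=> i; have := h (lift ord0 i); rewrite rV_consS.
case=> h0 hS i; case: (unliftP ord0 i) => [j|] ->; last by rewrite rV_cons0.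
by rewrite rV_consS.
Qed.

End lebesgue_rV.

Section sobolev.
Context {R : realType} {d : nat}.
Implicit Types (Omega : set 'rV[R]_d) (u v g phi : 'rV[R]_d -> R).

Definition bounded_domain Omega :=
  [/\ Omega !=set0, open Omega, connected Omega & bounded_set Omega].

Definition dotrV (x y : 'rV[R]_d) : R := \sum_(i < d) x ord0 i * y ord0 i.

(* Near each boundary point, Omega lies strictly above the graph, in the
   direction of a unit vector nu, of a Lipschitz function of the remaining
   coordinates (encoded by the invariance of h along nu). *)
Definition lipschitz_boundary Omega :=
  forall x, (closure Omega `\` interior Omega) x ->
  exists (r : R) (nu : 'rV[R]_d) (h : 'rV[R]_d -> R),
    [/\ 0 < r, dotrV nu nu = 1, [lipschitz h y | y in setT],
        (forall y (t : R), h (y + t *: nu) = h y)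
      & forall y, ball x r y -> (Omega y <-> h y < dotrV y nu)].

Definition partial (i : 'I_d) phi : 'rV[R]_d -> R :=
  fun x => 'D_(delta_mx ord0 i) phi x.

Definition smooth phi :=
  forall (s : seq 'I_d) x, differentiable (foldr partial phi s) x.

Definition test_function Omega phi :=
  [/\ smooth phi, compact (closure [set x | phi x != 0])
    & closure [set x | phi x != 0] `<=` Omega].

Local Notation mu := (@lebesgue_rV R d).

Definition L2norm Omega u : \bar R := 'N[mu]_2%:E[EFin \o (u \_ Omega)].

Definition Linftynorm Omega u : \bar R := 'N[mu]_+oo[EFin \o (u \_ Omega)].

Definition inL2 Omega u := measurable_fun Omega u /\ (L2norm Omega u < +oo)%E.

Definition is_weak_partial Omega (i : 'I_d) u g :=
  forall phi, test_function Omega phi ->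
  \int[mu]_(x in Omega) (u x * partial i phi x) =
  - \int[mu]_(x in Omega) (g x * phi x).

(* The weak derivative in L^2(Omega); a representative is chosen, the
   function being determined by u only up to a null set. *)
Definition weak_partial Omega (i : 'I_d) u : 'rV[R]_d -> R :=
  xget (cst 0) [set g | inL2 Omega g /\ is_weak_partial Omega i u g].

(* H^k(Omega) as { u in L^2 | every weak partial derivative is in H^(k-1) };
   g is in L^2 in both branches of the recursion. *)
Fixpoint sobolev Omega (k : nat) u : Prop :=
  match k with
  | 0 => inL2 Omega u
  | k'.+1 => inL2 Omega u /\
      forall i, exists2 g, is_weak_partial Omega i u g & sobolev Omega k' g
  end.

(* Closure of the test functions in H^1(Omega); no trace operator needed. *)
Definition sobolev10 Omega u :=
  sobolev Omega 1 u /\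
  exists phi : nat -> 'rV[R]_d -> R,
    [/\ forall k, test_function Omega (phi k),
        L2norm Omega (phi k \- u) @[k --> \oo] --> 0%E
      & forall i, L2norm Omega (partial i (phi k) \- weak_partial Omega i u)
                    @[k --> \oo] --> 0%E].

Definition laplacian Omega u : 'rV[R]_d -> R :=
  fun x => \sum_(i < d) weak_partial Omega i (weak_partial Omega i u) x.

Definition sqr_norm_grad Omega u : 'rV[R]_d -> R :=
  fun x => \sum_(i < d) weak_partial Omega i u x ^+ 2.

End sobolev.

Section scheme.
Context {R : realType}.

Definition Gamma (z : R) : R :=
  \int[@lebesgue_measure R]_(t in `]0, +oo[) (t `^ (z - 1) * expR (- t)).

Definition L1coef (alpha dt : R) (k : nat) : R :=
  (k.+1%:R `^ (1 - alpha) - k%:R `^ (1 - alpha)) /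
  (Gamma (2 - alpha) * dt `^ alpha).

Definition L1deriv d (alpha dt : R) (u : nat -> 'rV[R]_d -> R) (n : nat)
    (x : 'rV[R]_d) : R :=
  \sum_(1 <= k < n.+1) L1coef alpha dt (n - k) * (u k x - u k.-1 x).

Definition f_dw (s : R) : R := s ^+ 3 - s.

Definition F_dw (s : R) : R := 4^-1 * (s ^+ 2 - 1) ^+ 2.

(* The integrand is nonnegative, so the integral makes sense in [0, +oo] without
   assuming u in L^4. *)
Definition energy d (Omega : set 'rV[R]_d) (eps : R) (u : 'rV[R]_d -> R) :
    \bar R :=
  (\int[lebesgue_rV d]_(x in Omega)
    (eps ^+ 2 / 2 * sqr_norm_grad Omega u x + F_dw (u x))%:E)%E.

Definition modified_energy d (Omega : set 'rV[R]_d) (alpha gamma eps dt : R)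
    (u : nat -> 'rV[R]_d -> R) (n : nat) : \bar R :=
  let b := L1coef alpha dt in
  if n == 0%N then energy Omega eps (u 0%N)
  else
    (energy Omega eps (u n)
     + (1 / (2 * gamma))%:E *
         \sum_(1 <= k < n)
           (b (n - k - 1)%N - b (n - k)%N)%:E * L2norm Omega (u n \- u k)%R ^+ 2
     + (1 / (2 * gamma) * b (n - 1)%N)%:E * L2norm Omega (u n \- u 0%N)%R ^+ 2)%E.

End scheme.

(* Main.v *)
Require Import Defs.
From HB Require Import structures.
From mathcomp Require Import all_boot all_order all_algebra.
From mathcomp Require Import all_classical all_reals all_analysis.
From mathcomp Require Import measurable_realfun ess_sup_inf.
From mathcomp Require Import zify ring lra.

Set Implicit Arguments.
Unset Strict Implicit.
Unset Printing Implicit Defensive.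

Import Order.TTheory GRing.Theory Num.Theory.
Import numFieldNormedType.Exports.

Local Open Scope classical_set_scope.
Local Open Scope ring_scope.

(** The scheme is tested with [u n.+1 - u n].  Its left-hand side is, after
    summation by parts, [memory_sum b n.+1 (fun k => u n.+1 - u k)], with weights
    [b (n - k) - b (n + 1 - k)] and [b n].  Since [b] is nonincreasing and convex
    (signs of the second and third differences of a power with exponent in
    ]0, 1]), these weights are nonnegative and decrease when [n] grows, whence
    [memory_sum_energy]: the tested left-hand side dominates half the increment
    of the memory term of the modified energy.  On the right-hand side, the
    Laplacian yields the increment of the Dirichlet energy by integration by
    parts in [H^1_0] ([dirichlet_increment]), and a Taylor expansion of the
    potential, whose second derivative is at most 2 on [-1, 1], yields the
    increment of [F] up to a square that the stabilization [S >= 2] absorbs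
    ([scheme_energy_density]).

    The Taylor bound requires [|u n| <= 1] almost everywhere, which is proved by
    induction on [n] ([discrete_maximum_bound]).  Each step solves
    [A * v - kappa * Laplacian v = h] with [|h| <= A], and the maximum principle
    [elliptic_maximum_bound] is needed for weak solutions.  The classical test
    function, the truncation of [v] outside [-1, 1], would require the chain rule
    for Lipschitz functions in Sobolev spaces.  It is replaced by the smooth
    increasing functions [outer_part p s = s ^ (m + 1) / (1 + s ^ m)], [m] even,
    for which [outer_part p o phi] is again a test function whenever [phi] is;
    the sign of [int (Laplacian v) * outer_part p v] passes to the limit along
    test functions approximating [v], and [m -> oo] gives
    [int (max 0 (|v| - 1)) ^ 2 <= 0]. *)

(** * Coefficients of the L1 scheme *)

Section powR_differences.
Context {R : realType}.
Implicit Types a c x b q : R.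

(** Convexity of the inverse power. *)
Lemma powR_midpoint_concave a c b : 0 <= a -> 0 <= c -> 0 < b <= 1 ->
  a `^ b + c `^ b <= 2 * ((a + c) / 2) `^ b.
Proof.
move=> a0 c0 /andP[b0 b1].
have b'1 : 1 <= b^-1 by rewrite invf_ge1.
have h0 : (0 : R) <= 2^-1 by lra.
have h1 : 2^-1 <= (1 : R) by lra.
pose t : {i01 R} := Itv01 h0 h1.
have := @convex_powR R b^-1 b'1 t (a `^ b) (c `^ b).
rewrite !inE /= !in_itv/= !andbT !powR_ge0 => /(_ isT isT).
rewrite [X in _ <= X]convRE [X in X `^ _ <= _]convRE /= /unstable.onem.
rewrite -!powRrM mulfV ?gt_eqF// !powRr1// => h.
have s0 : 0 <= 2^-1 * a `^ b + (1 - 2^-1) * c `^ b.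
  by rewrite addr_ge0// mulr_ge0 ?powR_ge0//; lra.
have := @ge0_ler_powR R b (ltW b0) _ _ _ _ h.
rewrite !nnegrE powR_ge0 => /(_ isT).
have -> : 2^-1 * a + (1 - 2^-1) * c = (a + c) / 2 by field.
have -> : (0 <= (a + c) / 2)%R by lra.
move=> /(_ isT); rewrite -powRrM mulVf ?gt_eqF// powRr1//; lra.
Qed.

(** The arithmetic mean of [a `^ q] and [c `^ q] is at least their geometric
    mean, and the latter is the power of the geometric mean of [a] and [c]. *)
Lemma powR_midpoint_convex_neg a c q : 0 < a -> 0 < c -> q <= 0 ->
  2 * ((a + c) / 2) `^ q <= a `^ q + c `^ q.
Proof.
move=> a0 c0 q0.
have m0 : 0 < (a + c) / 2 by lra.
have h : (((a + c) / 2) `^ (q / 2)) ^+ 2 <= a `^ (q / 2) * c `^ (q / 2).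
  rewrite -powRM ?(ltW a0) ?(ltW c0)// expr2 -powRM ?(ltW m0)//.
  have -> : q / 2 = - (- q / 2) by ring.
  rewrite !(powRN _ (- q / 2)). rewrite lef_pV2 ?posrE ?powR_gt0 ?mulr_gt0 ?addr_gt0//.
  apply: ge0_ler_powR; [lra | by rewrite nnegrE mulr_ge0 ?(ltW a0) ?(ltW c0)
    | by rewrite nnegrE mulr_ge0 ?(ltW m0) |].
  have := sqr_ge0 (a - c); rewrite expr2; nra.
have E y : 0 < y -> y `^ q = (y `^ (q / 2)) ^+ 2.
  move=> y0; rewrite expr2 -powRD; last by rewrite (gt_eqF y0) implybT.
  by congr (_ `^ _); field.
rewrite (E _ m0) (E _ a0) (E _ c0); have := sqr_ge0 (a `^ (q / 2) - c `^ (q / 2)); nra.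
Qed.

(** The second difference [h t] with base point [t] has derivative [dh t >= 0]
    by convexity of the power [b - 1 <= 0], so [h x <= h (x + 1)].  The power
    [t `^ b] is differentiable on [t > 0] only; at [x = 0] mere continuity
    suffices for the mean value theorem. *)
Lemma powR_third_difference_ge0 x b : 0 <= x -> 0 < b <= 1 ->
  3 * (x + 2) `^ b + x `^ b <= (x + 3) `^ b + 3 * (x + 1) `^ b.
Proof.
move=> x0 /andP[b0 b1].
pose h (t : R) : R := (t + 2) `^ b - 2 * (t + 1) `^ b + t `^ b.
pose dh (t : R) : R :=
  b * ((t + 2) `^ (b - 1) - 2 * (t + 1) `^ (b - 1) + t `^ (b - 1)).
have dhE (t : R) : 0 < t -> is_derive t 1 h (dh t).
  move=> t0.
  have d1 (s : R) : 0 < t + s ->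
      is_derive t 1 (fun y : R => (y + s) `^ b) (b * (t + s) `^ (b - 1)).
    move=> ts.
    have := @is_derive1_comp R (@powR R ^~ b) (fun y => y + s) t
      (b * (t + s) `^ (b - 1)) 1 (is_derive1_powR _ ts).
    rewrite mulr1; apply.
    by apply: is_derive_eq; rewrite addr0.
  have t2 : 0 < t + 2 by lra.
  have t1 : 0 < t + 1 by lra.
  have := d1 _ t2; have := d1 _ t1; have := @is_derive1_powR R b t t0.
  move=> D0 D1 D2.
  have -> : dh t = b * (t + 2) `^ (b - 1) - 2 *: (b * (t + 1) `^ (b - 1))
      + b * t `^ (b - 1) by rewrite /dh /GRing.scale/=; ring.
  exact: is_deriveD (is_deriveB D2 (is_deriveZ 2 D1)) D0.
have ht0 (t : R) : 0 < t -> {for t, continuous h}.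
  move=> /dhE dt; apply: differentiable_continuous.
  by apply/derivable1_diffP; exact: ex_derive.
suff : h x <= h (x + 1).
  rewrite /h -!addrA (_ : (1 + 2 : R) = 3); last by ring.
  rewrite (_ : (1 + 1 : R) = 2); last by ring.
  lra.
have [c + /eqP] : exists2 c, c \in `]x, x + 1[%R
    & h (x + 1) - h x = dh c * (x + 1 - x).
  apply: MVT.
  - lra.
  - by move=> t; rewrite in_itv/= => /andP[xt _]; apply: dhE; lra.
  - apply/continuous_within_itvP; first lra.
    split.
    + by move=> t; rewrite in_itv/= => /andP[xt _]; apply: ht0; lra.
    + rewrite /h; have [->|x_neq0] := eqVneq x 0; last first.
        by apply/cvg_at_right_filter/ht0; rewrite lt_neqAle eq_sym x_neq0.
      rewrite powR0 ?gt_eqF//; apply: cvgD; last exact: powR_cvg0.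
      apply: cvg_at_right_filter.
      have c1 (s : R) : 0 < s -> (t + s) `^ b @[t --> (0 : R)] --> (0 + s) `^ b.
        move=> s0.
        have : {for 0 + s, continuous (@powR R ^~ b)}.
          apply: differentiable_continuous; apply/derivable1_diffP.
          by apply: ex_derive; apply: is_derive1_powR; lra.
        have cf : {for 0, continuous (fun t : R => t + s)}.
          by apply: cvgD; [exact: cvg_id | exact: cvg_cst].
        by move=> cs; exact: (continuous_comp cf cs).
      by apply: cvgB; [exact: c1 | apply: cvgM; [exact: cvg_cst | exact: c1]].
    + by apply/cvg_at_left_filter/ht0; lra.
rewrite in_itv/= => /andP[xc _].
rewrite subr_eq => /eqP ->.
rewrite addrAC subrr add0r mulr1 lerDr /dh mulr_ge0 ?(ltW b0)//.
have := @powR_midpoint_convex_neg (c + 2) c (b - 1).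
rewrite (_ : (c + 2 + c) / 2 = c + 1); last by field.
have c2 : 0 < c + 2 by lra.
have c0 : 0 < c by lra.
by move=> /(_ c2 c0); rewrite subr_le0 => /(_ b1); lra.
Qed.

End powR_differences.

Section L1coef_theory.
Context {R : realType}.
Implicit Types (alpha dt z : R) (k : nat).

Lemma Gamma_ge0 z : 0 <= Gamma z.
Proof. by apply: Rintegral_ge0 => t _; rewrite mulr_ge0 ?powR_ge0 ?expR_ge0. Qed.

Lemma L1coef_denom_ge0 alpha dt : 0 <= (Gamma (2 - alpha) * dt `^ alpha)^-1.
Proof. by rewrite invr_ge0 mulr_ge0 ?Gamma_ge0 ?powR_ge0. Qed.

Lemma L1coef_ge0 alpha dt k : alpha < 1 -> 0 <= L1coef alpha dt k.
Proof.
move=> a1; rewrite /L1coef mulr_ge0 ?L1coef_denom_ge0// subr_ge0.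
by apply: ge0_ler_powR; rewrite ?nnegrE ?ler_nat//; lra.
Qed.

Lemma L1coef_nonincreasing alpha dt k : 0 < alpha < 1 ->
  L1coef alpha dt k.+1 <= L1coef alpha dt k.
Proof.
move=> /andP[a0 a1]; rewrite /L1coef ler_wpM2r ?L1coef_denom_ge0//.
have := @powR_midpoint_concave R k.+2%:R k%:R (1 - alpha) (ler0n _ _) (ler0n _ _).
rewrite (_ : (k.+2%:R + k%:R) / 2 = k.+1%:R); last first.
  by rewrite -addn2 -addn1 !natrD; field.
move=> H; have {H} := H _; lra.
Qed.

(** Convexity of [k |-> b_k] is nonnegativity of a third difference of
    [x `^ (1 - alpha)]. *)
Lemma L1coef_convex alpha dt k : 0 < alpha < 1 ->
  L1coef alpha dt k.+1 - L1coef alpha dt k.+2 <=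
  L1coef alpha dt k - L1coef alpha dt k.+1.
Proof.
move=> /andP[a0 a1]; rewrite /L1coef -!mulrBl ler_wpM2r ?L1coef_denom_ge0//.
have b01 : 0 < 1 - alpha <= 1 by apply/andP; split; lra.
have := powR_third_difference_ge0 (ler0n R k) b01.
by rewrite -[k.+3]addn3 -[k.+2]addn2 -[k.+1]addn1 !natrD; lra.
Qed.

End L1coef_theory.

Section memory_sum.
Context {R : realType}.
Implicit Types (a b g h : nat -> R) (n k : nat).

(** Written with [g k = a n - a k] this is the discrete fractional derivative
    of [a] after summation by parts; with [g k = ||u n - u k||^2] it is the
    memory term of the modified energy.  For [n = 0] it is [b 0 * g 0]. *)
Definition memory_sum b n g : R :=
  \sum_(1 <= k < n) (b (n - k - 1)%N - b (n - k)%N) * g k + b (n - 1)%N * g 0%N.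

(** Summation by parts. *)
Lemma memory_sumE b n a : (0 < n)%N ->
  \sum_(1 <= k < n.+1) b (n - k)%N * (a k - a k.-1) =
  memory_sum b n (fun k => a n - a k).
Proof.
move=> n0; suff H m : (0 < m)%N ->
    \sum_(1 <= k < m.+1) b (n - k)%N * (a k - a k.-1) =
    \sum_(1 <= k < m) (b (n - k - 1)%N - b (n - k)%N) * (a n - a k)
    + b (n - 1)%N * (a n - a 0%N) - b (n - m)%N * (a n - a m).
  by rewrite H// subrr mulr0 subr0.
elim: m => [//|[_ _|m IH _]]; first by rewrite big_nat1 big_geq//; ring.
rewrite big_nat_recr//= IH// [in RHS]big_nat_recr//=.
have -> : (n - m.+1 - 1 = n - m.+2)%N by lia.
ring.
Qed.

Lemma eq_memory_sum b n g h : (forall k, (k <= n)%N -> g k = h k) ->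
  memory_sum b n g = memory_sum b n h.
Proof.
move=> gh; rewrite /memory_sum gh//; congr (_ + _).
by rewrite !big_nat; apply: eq_bigr => k /andP[_ /ltnW kn]; rewrite gh.
Qed.

Lemma memory_sum_cst b n (c : R) : memory_sum b n (fun=> c) = b 0%N * c.
Proof.
rewrite /memory_sum -mulr_suml -mulrDl; congr (_ * _).
case: n => [|n]; first by rewrite big_geq// add0r.
suff H m : (0 < m <= n.+1)%N -> \sum_(1 <= k < m)
    (b (n.+1 - k - 1)%N - b (n.+1 - k)%N) = b (n.+1 - m)%N - b n.
  rewrite H ?leqnn//.
  by rewrite subnn subn1 subrK.
elim: m => [//|[_ _|m IH /andP[_ mn]]].
  by rewrite big_geq// subn1 subrr.
rewrite big_nat_recr//= IH ?(ltnW mn)//.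
have -> : (n.+1 - m.+1 - 1 = n.+1 - m.+2)%N by lia.
ring.
Qed.

Lemma memory_sumB b n g h :
  memory_sum b n (fun k => g k - h k) = memory_sum b n g - memory_sum b n h.
Proof.
rewrite /memory_sum opprD addrACA -sumrB mulrBr; congr (_ + _).
by apply: eq_bigr => k _; rewrite mulrBr.
Qed.

Lemma memory_sumMr b n g (c : R) :
  memory_sum b n (fun k => g k * c) = memory_sum b n g * c.
Proof.
rewrite /memory_sum mulrDl mulr_suml mulrA; congr (_ + _).
by apply: eq_bigr => k _; rewrite mulrA.
Qed.

Section monotone_weights.
Variable b : nat -> R.
Hypothesis b_ge0 : forall k, 0 <= b k.
Hypothesis b_nonincreasing : forall k, b k.+1 <= b k.
Hypothesis b_convex : forall k, b k.+1 - b k.+2 <= b k - b k.+1.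

Lemma memory_weight_ge0 n k : (k < n)%N ->
  0 <= b (n - k - 1)%N - b (n - k)%N.
Proof.
move=> kn; rewrite (_ : (n - k = (n - k - 1).+1)%N); last lia.
by rewrite subn1 subr_ge0.
Qed.

Lemma le_memory_sum n g h : (forall k, (k < n)%N || (k == 0)%N -> g k <= h k) ->
  memory_sum b n g <= memory_sum b n h.
Proof.
move=> gh; rewrite lerD ?ler_wpM2l ?gh ?eqxx ?orbT//.
rewrite !big_nat; apply: ler_sum => k /andP[_ kn].
by rewrite ler_wpM2l ?gh ?kn// memory_weight_ge0.
Qed.

Lemma memory_sum_shift n g : (forall k, 0 <= g k) -> g n = 0 ->
  memory_sum b n.+1 g <= memory_sum b n g.
Proof.
move=> g0 gn; case: n gn => [gn|n gn].
  by rewrite /memory_sum !big_geq// gn !mulr0.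
rewrite /memory_sum big_nat_recr//= gn mulr0 addr0 lerD//; last first.
  by rewrite ler_wpM2r// !subn1 /=.
rewrite !big_nat; apply: ler_sum => k /andP[_ kn]; rewrite ler_wpM2r//.
have -> : (n.+2 - k = (n - k).+2)%N by lia.
have -> : (n.+1 - k = (n - k).+1)%N by lia.
by rewrite !subn1 /=.
Qed.

(** Discrete counterpart of [v * D^alpha v >= D^alpha (v^2) / 2].  Termwise,
    [2 (v - c) (v - w) = (v - c)^2 - (w - c)^2 + (v - w)^2]; shifting the weights
    from [n.+1] to [n] costs nothing because they decrease and the term [k = n] of
    the second sum vanishes. *)
Lemma memory_sum_energy n a :
  (memory_sum b n.+1 (fun k => (a n.+1 - a k) ^+ 2)
   - memory_sum b n (fun k => (a n - a k) ^+ 2)) / 2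
  <= memory_sum b n.+1 (fun k => a n.+1 - a k) * (a n.+1 - a n).
Proof.
have shift : memory_sum b n.+1 (fun k => (a n - a k) ^+ 2)
    <= memory_sum b n (fun k => (a n - a k) ^+ 2).
  by apply: memory_sum_shift => [k|]; rewrite ?sqr_ge0// subrr expr0n.
rewrite -memory_sumMr; apply: (@le_trans _ _ ((memory_sum b n.+1
    (fun k => (a n.+1 - a k) ^+ 2)
   - memory_sum b n.+1 (fun k => (a n - a k) ^+ 2)) / 2)); first lra.
rewrite -memory_sumB -memory_sumMr; apply: le_memory_sum => k _.
by have := sqr_ge0 (a n.+1 - a n); rewrite !expr2; nra.
Qed.

End monotone_weights.

End memory_sum.

(** * Square-integrable functions *)

Section square_integrable.
Context d {T : measurableType d} {R : realType}.
Variables (mu : {measure set T -> \bar R}) (D : set T).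
Hypothesis mD : measurable D.
Implicit Types f g h : T -> R.

Definition square_integrable f :=
  measurable_fun D f /\ mu.-integrable D (EFin \o (fun x => f x ^+ 2)).

Lemma square_integrable_mul f g : square_integrable f -> square_integrable g ->
  mu.-integrable D (EFin \o (fun x => f x * g x)).
Proof.
move=> [mf f2] [mg g2].
apply: (@le_integrable _ _ _ mu D mD _ (EFin \o (fun x => f x ^+ 2 + g x ^+ 2))).
- by apply/measurable_EFinP; exact: measurable_funM.
- move=> x _ /=; rewrite lee_fin [leRHS]ger0_norm ?addr_ge0 ?sqr_ge0// normrM.
  rewrite -[f x ^+ 2]real_normK ?num_real// -[g x ^+ 2]real_normK ?num_real//.
  by have := sqr_ge0 (`|f x| - `|g x|); rewrite !expr2;
    have := mulr_ge0 (normr_ge0 (f x)) (normr_ge0 (g x)); lra.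
- exact: integrableD f2 g2.
Qed.

Lemma square_integrable_dominated f g : measurable_fun D f ->
  (forall x, D x -> `|f x| <= `|g x|) -> square_integrable g ->
  square_integrable f.
Proof.
move=> mf fg [mg g2]; split => //.
apply: (@le_integrable _ _ _ mu D mD _ (EFin \o (fun x => g x ^+ 2))) => //.
- by apply/measurable_EFinP; exact: measurable_funX.
- by move=> x Dx /=; rewrite lee_fin !normrX lerXn2r ?nnegrE// fg.
Qed.

Lemma square_integrableZ (c : R) f : square_integrable f ->
  square_integrable (fun x => c * f x).
Proof.
move=> [mf f2]; split; first exact: measurable_funM.
rewrite (_ : _ \o _ = (fun x => ((c ^+ 2)%R)%:E * (EFin \o (fun x => f x ^+ 2)%R) x)%E).
  exact: integrableZl.
by apply/funext => x /=; rewrite exprMn EFinM.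
Qed.

Lemma square_integrableD f g : square_integrable f -> square_integrable g ->
  square_integrable (fun x => f x + g x).
Proof.
move=> sf sg; have fg := square_integrable_mul sf sg.
have [[mf f2] [mg g2]] := (sf, sg).
split; first exact: measurable_funD.
rewrite (_ : _ \o _ = ((EFin \o (fun x => f x ^+ 2)%R) \+
    ((fun x => 2%:E * (EFin \o (fun x => f x * g x)%R) x)
      \+ (EFin \o (fun x => g x ^+ 2)%R)))%E).
  by apply: integrableD => //; apply: integrableD => //; exact: integrableZl.
by apply/funext => x /=; rewrite -EFinM -!EFinD; congr EFin; ring.
Qed.

Lemma square_integrableB f g : square_integrable f -> square_integrable g ->
  square_integrable (fun x => f x - g x).
Proof.
move=> sf sg; have := square_integrableD sf (square_integrableZ (-1) sg).
by under eq_fun do rewrite mulN1r.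
Qed.

Lemma square_integrable_sum (I : Type) (s : seq I) (F : I -> T -> R) :
  (forall i, square_integrable (F i)) ->
  square_integrable (fun x => \sum_(i <- s) F i x).
Proof.
move=> sF; elim: s => [|i s IH].
  under eq_fun do rewrite big_nil; split; first exact: measurable_cst.
  rewrite (_ : _ \o _ = cst 0%E); first exact: integrable0.
  by apply/funext => x /=; rewrite expr0n.
by under eq_fun do rewrite big_cons; exact: square_integrableD.
Qed.

Lemma square_integrable_bounded (M : R) f : (mu D < +oo)%E ->
  measurable_fun D f -> (forall x, D x -> `|f x| <= M) -> square_integrable f.
Proof.
move=> muD mf fM; apply: (@square_integrable_dominated _ (cst M)) => //.
  by move=> x Dx; rewrite (le_trans (fM x Dx))// ler_norm.
split; first exact: measurable_cst.
rewrite (_ : _ \o _ = cst (M ^+ 2)%:E)//.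
apply/integrableP; split; first exact: measurable_cst.
rewrite (eq_integral (cst `|(M ^+ 2)%:E|%E))// integral_cst//.
by rewrite lte_mul_pinfty// abse_ge0.
Qed.

Lemma ae_le_Rintegral f g : mu.-integrable D (EFin \o f) ->
  mu.-integrable D (EFin \o g) ->
  {ae mu, forall x, D x -> f x <= g x} ->
  \int[mu]_(x in D) f x <= \int[mu]_(x in D) g x.
Proof.
move=> If Ig fg; rewrite -subr_ge0 -RintegralB//.
have mf : measurable_fun D f by apply/measurable_EFinP; exact: measurable_int If.
have mg : measurable_fun D g by apply/measurable_EFinP; exact: measurable_int Ig.
rewrite /Rintegral (ae_eq_integral (EFin \o (fun x => Num.max 0 (g x - f x))))//.
- by apply: Rintegral_ge0 => x _; rewrite le_max lexx.
- by apply/measurable_EFinP; exact: measurable_funB.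
- by apply/measurable_EFinP; apply: measurable_maxr => //; exact: measurable_funB.
- apply: filterS fg => x h Dx /=; congr EFin; apply/esym/max_idPr.
  by rewrite subr_ge0 h.
Qed.

Lemma Rintegral_eq0_ae f : mu.-integrable D (EFin \o f) ->
  (forall x, D x -> 0 <= f x) -> \int[mu]_(x in D) f x <= 0 ->
  {ae mu, forall x, D x -> f x = 0}.
Proof.
move=> If f0 I0.
have mf : measurable_fun D (EFin \o f) by exact: measurable_int If.
have : (\int[mu]_(x in D) `|(EFin \o f) x| = 0)%E.
  under eq_integral => x /[1!inE] Dx do rewrite gee0_abs ?lee_fin ?f0//.
  rewrite -(fineK (integrable_fin_num mD If)); congr EFin.
  by apply/eqP; rewrite eq_le I0/=; exact: Rintegral_ge0.
move/(ae_eq_integral_abs mu mD mf); apply: filterS => x h Dx.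
by have /= [] := h Dx.
Qed.

Lemma cauchy_schwarz_Rintegral f g : square_integrable f -> square_integrable g ->
  (\int[mu]_(x in D) (f x * g x)) ^+ 2 <=
  (\int[mu]_(x in D) (f x ^+ 2)) * (\int[mu]_(x in D) (g x ^+ 2)).
Proof.
move=> sf sg; set a := \int[mu]_(x in D) (f x ^+ 2).
set b := \int[mu]_(x in D) (g x ^+ 2); set c := \int[mu]_(x in D) (f x * g x).
have Q (s t : R) : 0 <= s ^+ 2 * a - 2 * s * t * c + t ^+ 2 * b.
  rewrite /a /b /c -!RintegralZl//;
    [|exact: sg.2|exact: square_integrable_mul|exact: sf.2].
  have Z1 := integrableZl mD (s ^+ 2) sf.2.
  have Z2 := integrableZl mD (2 * s * t) (square_integrable_mul sf sg).
  have Z3 := integrableZl mD (t ^+ 2) sg.2.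
  rewrite -RintegralB// -RintegralD//; last exact: (integrableB mD Z1 Z2).
  apply: Rintegral_ge0 => x _.
  by have := sqr_ge0 (s * f x - t * g x); rewrite !expr2; lra.
have a0 : 0 <= a by apply: Rintegral_ge0 => x _; exact: sqr_ge0.
have b0 : 0 <= b by apply: Rintegral_ge0 => x _; exact: sqr_ge0.
have [b00|bN] := eqVneq b 0.
  (* these [s] and [t] make the form equal to [- c ^+ 2] *)
  have := Q c ((a + 1) / 2); rewrite b00 !mulr0 addr0; lra.
have := Q b c; have bp : 0 < b by rewrite lt_neqAle eq_sym bN.
rewrite (_ : _ + _ = b * (a * b - c ^+ 2)); last by ring.
by rewrite pmulr_rge0// subr_ge0.
Qed.

(** Transfers identities tested on an approximating sequence to its limit. *)
Lemma cvg_Rintegral_mul (fk : nat -> T -> R) f g :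
  (forall k, square_integrable (fk k)) -> square_integrable f ->
  square_integrable g ->
  (\int[mu]_(x in D) ((fk k x - f x) ^+ 2)) @[k --> \oo] --> (0 : R) ->
  (\int[mu]_(x in D) (fk k x * g x)) @[k --> \oo] -->
    \int[mu]_(x in D) (f x * g x).
Proof.
move=> sfk sf sg fkf; apply/cvgrPdist_le => e e0.
set b := \int[mu]_(x in D) (g x ^+ 2).
have b0 : 0 <= b by apply: Rintegral_ge0 => x _; exact: sqr_ge0.
have eb : 0 < e ^+ 2 / (b + 1) by rewrite divr_gt0 ?exprn_gt0// ltr_pwDr.
have /cvgrPdist_le/(_ _ eb) := fkf; apply: filterS => k.
rewrite sub0r normrN ger0_norm; last first.
  by apply: Rintegral_ge0 => x _; exact: sqr_ge0.
move=> h; rewrite distrC -RintegralB//; [|exact: square_integrable_mul..].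
under eq_Rintegral do rewrite -mulrBl.
rewrite -(ler_pXn2r (n := 2))// ?nnegrE ?(ltW e0)// real_normK ?num_real//.
apply: (le_trans (cauchy_schwarz_Rintegral (square_integrableB (sfk k) sf) sg)).
apply: (le_trans (ler_wpM2r b0 h)).
rewrite mulrAC ler_pdivrMr ?ltr_pwDr//.
by have := sqr_ge0 e; nra.
Qed.

End square_integrable.

Section Rintegral_complements.
Context d {T : measurableType d} {R : realType}.
Variables (mu : {measure set T -> \bar R}) (D : set T).
Hypothesis mD : measurable D.
Implicit Types f : T -> R.

Lemma integrable_sumR (I : Type) (s : seq I) (F : I -> T -> R) :
  (forall i, mu.-integrable D (EFin \o F i)) ->
  mu.-integrable D (EFin \o (fun x => \sum_(i <- s) F i x)).
Proof.
move=> iF; elim: s => [|i s IH].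
  rewrite (_ : _ \o _ = cst 0%E); first exact: integrable0.
  by apply/funext => x /=; rewrite big_nil.
rewrite (_ : _ \o _ = ((EFin \o F i)
    \+ (EFin \o (fun x => \sum_(i <- s) F i x)%R))%E).
  exact: integrableD.
by apply/funext => x /=; rewrite big_cons EFinD.
Qed.

Lemma Rintegral_sum (I : Type) (s : seq I) (F : I -> T -> R) :
  (forall i, mu.-integrable D (EFin \o F i)) ->
  \int[mu]_(x in D) (\sum_(i <- s) F i x) =
  \sum_(i <- s) \int[mu]_(x in D) F i x.
Proof.
move=> iF; elim: s => [|i s IH].
  rewrite big_nil; under eq_Rintegral do rewrite big_nil.
  by rewrite Rintegral_cst// mul0r.
rewrite big_cons -IH -RintegralD//; last exact: integrable_sumR.
by apply: eq_Rintegral => x _; rewrite big_cons.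
Qed.

Lemma integrable_ae_bounded (M : R) f : (mu D < +oo)%E ->
  measurable_fun D f -> {ae mu, forall x, D x -> `|f x| <= M} ->
  mu.-integrable D (EFin \o f).
Proof.
move=> muD mf fM; apply/integrableP; split; first exact/measurable_EFinP.
apply: (@le_lt_trans _ _ (\int[mu]_(x in D) (cst `|M|%:E) x)%E).
  apply: ae_ge0_le_integral => //.
  - by apply: measurableT_comp => //; exact/measurable_EFinP.
  - by move=> x _; rewrite /= lee_fin.
  - by apply: filterS fM => x h Dx; rewrite /= lee_fin (le_trans (h Dx))// ler_norm.
by rewrite integral_cst// lte_mul_pinfty// lee_fin.
Qed.

End Rintegral_complements.

(** * Lebesgue measure on row vectors *)

Section rV_measure.
Context {R : realType} {n : nat}.
Implicit Types (U : set 'rV[R]_n) (f : 'rV[R]_n -> R).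

Lemma measurable_box_rV (A : 'I_n -> set (measurableTypeR R)) :
  (forall i, measurable (A i)) ->
  measurable [set x : 'rV[R]_n | forall i, A i (x ord0 i)].
Proof.
move=> mA; rewrite [X in measurable X](_ : _ =
    \bigcap_(i in [set: 'I_n]) (coord_rV i @^-1` A i)).
  apply: fin_bigcap_measurable => // i _.
  by rewrite -[X in measurable X]setTI; exact: measurable_coord_rV.
by apply/seteqP; split => x /= h i *; exact: h.
Qed.

(** An open set is the union of the boxes with rational corners it contains. *)
Lemma open_measurable_rV U : open U -> measurable U.
Proof.
move=> oU; pose Q : Type := ('rV[rat]_n * 'rV[rat]_n)%type.
pose edge (q : Q) i : set (measurableTypeR R) :=
  `](ratr (q.1 ord0 i)), (ratr (q.2 ord0 i))[%classic.
pose box (q : Q) : set 'rV[R]_n := [set x | forall i, edge q i (x ord0 i)].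
have mbox q : measurable (box q).
  by apply: (@measurable_box_rV (edge q)) => i; exact: measurable_itv.
rewrite (_ : U = \bigcup_(q : Q) (if `[< box q `<=` U >] then box q else set0)).
  apply: countable_bigcupT_measurable; first exact: countableP.
  by move=> q; case: ifPn.
apply/seteqP; split => [x Ux|x [q _]]; last first.
  by case: ifPn => // /asboolP; exact.
have /nbhs_ballP[e /= e0 xeU] : nbhs x U by exact: open_nbhs_nbhs.
have /choice[a ha] : forall i, exists q : rat,
    ratr q \in `](x ord0 i - e), (x ord0 i)[.
  by move=> i; apply: rat_in_itvoo; rewrite gtrBl.
have /choice[b hb] : forall i, exists q : rat,
    ratr q \in `](x ord0 i), (x ord0 i + e)[.
  by move=> i; apply: rat_in_itvoo; rewrite ltrDl.
exists ((\row_i a i), (\row_i b i)) => //.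
have bx : box ((\row_i a i), (\row_i b i)) x.
  move=> i; rewrite /edge/= !mxE in_itv/=.
  by rewrite (itvP (ha i)) (itvP (hb i)).
rewrite ifT//; apply/asboolP => y yb; apply: xeU; split => // i j.
rewrite (ord1 i) /ball/= ltr_norml.
have := yb j; rewrite /edge/= !mxE in_itv/= => /andP[y1 y2].
have := ha j; rewrite in_itv/= => /andP[a1 a2].
have := hb j; rewrite in_itv/= => /andP[b1 b2].
by apply/andP; split; lra.
Qed.

Lemma continuous_measurable_fun_rV f : continuous f -> measurable_fun setT f.
Proof.
move=> /continuousP cf; apply: (measurability _ (RGenOpens.measurableE R)).
move=> _ [_ [a [b ->] <-]]; rewrite setTI; apply: open_measurable_rV.
exact/cf/interval_open.
Qed.

Lemma bounded_lebesgue_rV_lty U : measurable U -> bounded_set U ->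
  (lebesgue_rV n U < +oo)%E.
Proof.
move=> mU [M [_ bM]].
pose A (i : 'I_n) : set (measurableTypeR R) := `](- (M + 2)), (M + 2)[%classic.
have mA i : measurable (A i) by exact: measurable_itv.
apply: (@le_lt_trans _ _ (lebesgue_rV n [set x | forall i, A i (x ord0 i)])).
  apply: le_measure; rewrite ?inE//; first exact: (@measurable_box_rV A).
  move=> x Ux i; have /= xM : `|x| <= M + 1 by apply: (bM (M + 1)) => //; lra.
  have : ball (0 : 'rV[R]_n) (M + 2) x.
    by rewrite mx_norm_ball /ball_ /= sub0r normrN; lra.
  move=> [_ /(_ ord0 i)]; rewrite /ball/= mxE sub0r normrN ltr_norml.
  by rewrite /A/= in_itv/=.
rewrite lebesgue_rV_box//.
suff : (\prod_(i < n) lebesgue_measure (A i))%E \is a fin_num.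
  by rewrite fin_numE ltey => /andP[].
elim/big_ind: _ => //; first by move=> x y; exact: fin_numM.
by move=> i _; rewrite /A lebesgue_measure_itv/=; case: ifP.
Qed.

End rV_measure.

(** * Smooth functions and test functions *)

Section smooth_functions.
Context {R : realType} {d : nat}.
Implicit Types (f g w phi psi : 'rV[R]_d -> R) (i : 'I_d).

Lemma smooth_differentiable f x : smooth f -> differentiable f x.
Proof. by move=> /(_ [::] x). Qed.

Lemma smooth_continuous f : smooth f -> continuous f.
Proof. by move=> sf x; exact/differentiable_continuous/smooth_differentiable. Qed.

Lemma smooth_partial i f : smooth f -> smooth (partial i f).
Proof. by move=> sf s x; have := sf (rcons s i) x; rewrite foldr_rcons. Qed.

Lemma partial_cst i (c : R) : partial i (cst c : 'rV[R]_d -> R) = cst 0.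
Proof. by apply/funext => x; exact: derive_cst. Qed.

Lemma smooth_cst (c : R) : smooth (cst c : 'rV[R]_d -> R).
Proof.
move=> s x; suff [b ->] : exists b : R, foldr partial (cst c) s = cst b.
  exact: differentiable_cst.
elim: s => [|i s [b IH]] /=; first by exists c.
by exists 0; rewrite IH partial_cst.
Qed.

(** The ring generated by the smooth functions and one inverse.  It consists of
    differentiable functions and is stable under partial derivatives, hence
    consists of smooth functions: this spares computing iterated derivatives of
    products and quotients. *)
Inductive smooth_ring w : ('rV[R]_d -> R) -> Prop :=
| smooth_ring_base f : smooth f -> smooth_ring w f
| smooth_ring_add f g : smooth_ring w f -> smooth_ring w g ->
    smooth_ring w (f + g)
| smooth_ring_mul f g : smooth_ring w f -> smooth_ring w g ->
    smooth_ring w (f * g)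
| smooth_ring_inv : smooth_ring w (fun x => (w x)^-1).

Section smooth_ring.
Variable w : 'rV[R]_d -> R.
Hypotheses (sw : smooth w) (w0 : forall x, w x != 0).

Lemma smooth_ring_differentiable f x : smooth_ring w f -> differentiable f x.
Proof.
elim=> [{}f sf|{}f g _ ff _ fg|{}f g _ ff _ fg|].
- exact: smooth_differentiable.
- exact: differentiableD.
- exact: differentiableM.
- by apply: differentiableV => //; exact: smooth_differentiable.
Qed.

Lemma smooth_ring_partial i f : smooth_ring w f -> smooth_ring w (partial i f).
Proof.
have dv f' x v : smooth_ring w f' -> derivable f' x v.
  by move=> sf; exact/diff_derivable/smooth_ring_differentiable.
elim=> [{}f sf|{}f g sf dsf sg dsg|{}f g sf dsf sg dsg|].
- by constructor; exact: smooth_partial.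
- rewrite (_ : partial i _ = partial i f + partial i g).
    exact: smooth_ring_add.
  by apply/funext => x; rewrite /partial deriveD//; exact: dv.
- rewrite (_ : partial i _ = f * partial i g + g * partial i f).
    by apply: smooth_ring_add; exact: smooth_ring_mul.
  by apply/funext => x; rewrite /partial deriveM//; exact: dv.
- rewrite (_ : partial i _ = cst (-1) *
      ((fun x => (w x)^-1) * ((fun x => (w x)^-1) * partial i w))).
    apply: smooth_ring_mul; first by constructor; exact: smooth_cst.
    do 2 (apply: smooth_ring_mul; first exact: smooth_ring_inv).
    by constructor; exact: smooth_partial.
  apply/funext => x; rewrite /partial deriveV//; last first.
    by apply: dv; constructor.
  rewrite /GRing.scale/= expr2 invfM.
  rewrite -[RHS]/(-1 * ((w x)^-1 * ((w x)^-1 * 'D_(delta_mx ord0 i) w x))).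
  by rewrite mulN1r mulNr mulrA.
Qed.

Lemma smooth_ring_smooth f : smooth_ring w f -> smooth f.
Proof.
move=> sf s x; apply: smooth_ring_differentiable.
by elim: s => [//|i s IH] /=; exact: smooth_ring_partial.
Qed.

End smooth_ring.

Lemma smoothD f g : smooth f -> smooth g -> smooth (fun x => f x + g x).
Proof.
move=> sf sg; apply: (@smooth_ring_smooth (cst 1)) => [|x|].
- exact: smooth_cst.
- by rewrite oner_eq0.
- by apply: smooth_ring_add; constructor.
Qed.

Lemma smoothM f g : smooth f -> smooth g -> smooth (fun x => f x * g x).
Proof.
move=> sf sg; apply: (@smooth_ring_smooth (cst 1)) => [|x|].
- exact: smooth_cst.
- by rewrite oner_eq0.
- by apply: smooth_ring_mul; constructor.
Qed.

Lemma smoothX f m : smooth f -> smooth (fun x => f x ^+ m).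
Proof.
move=> sf; elim: m => [|m IH]; first exact: smooth_cst.
by under eq_fun do rewrite exprS; exact: smoothM.
Qed.

Lemma smoothV w : smooth w -> (forall x, w x != 0) -> smooth (fun x => (w x)^-1).
Proof.
by move=> sw w0; apply: (smooth_ring_smooth sw w0); exact: smooth_ring_inv.
Qed.

Lemma partial_comp i (G : R -> R) (dG : R) phi x : differentiable phi x ->
  is_derive (phi x) 1 G dG -> partial i (G \o phi) x = dG * partial i phi x.
Proof.
move=> dphi dGx; have DG : differentiable G (phi x).
  by apply/derivable1_diffP; exact: ex_derive.
rewrite /partial deriveE; last exact: differentiable_comp.
rewrite diff_comp//= deriveE// -[X in 'd G _ X]mulr1.
rewrite (_ : _ * 1 = 'd phi x (delta_mx ord0 i) *: (1 : R))// linearZ/=.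
have -> : 'd G (phi x) 1 = dG by rewrite -deriveE// derive_val.
exact: mulrC.
Qed.

End smooth_functions.

Section test_functions.
Context {R : realType} {d : nat}.
Variable Omega : set 'rV[R]_d.
Implicit Types (phi psi : 'rV[R]_d -> R) (i : 'I_d).

Lemma test_function_sub phi psi : test_function Omega phi -> smooth psi ->
  [set x | psi x != 0] `<=` closure [set x | phi x != 0] ->
  test_function Omega psi.
Proof.
move=> [_ cphi phiO] spsi sub.
have csub : closure [set x | psi x != 0] `<=` closure [set x | phi x != 0].
  rewrite [X in _ `<=` X](closure_id _).1; last exact: closed_closure.
  exact: closure_subset.
split=> //; last exact: subset_trans phiO.
by apply: subclosed_compact cphi csub; exact: closed_closure.
Qed.

Lemma test_function_partial i phi :
  test_function Omega phi -> test_function Omega (partial i phi).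
Proof.
move=> tphi; have [sphi _ _] := tphi.
apply: (test_function_sub tphi); first exact: smooth_partial.
move=> x /=; apply: contraPP => nx; apply/negP; rewrite negbK.
have : nbhs x (~` closure [set x | phi x != 0]).
  by apply: open_nbhs_nbhs; split => //; exact/closed_openC/closed_closure.
move=> nbx; rewrite /partial (@near_eq_derive _ _ _ _ (cst 0)) ?derive_cst//.
apply: filterS nbx => y /= ny; apply/eqP/negPn/negP => fy; apply: ny.
exact: subset_closure.
Qed.

Lemma test_function_bounded phi : test_function Omega phi ->
  exists M, forall x, `|phi x| <= M.
Proof.
move=> [sphi cphi _].
have : compact (phi @` closure [set x | phi x != 0]).
  apply: continuous_compact cphi.
  exact/continuous_subspaceT/smooth_continuous.
move=> /compact_bounded[M [_ bM]]; exists (Num.max 0 (M + 1)) => x.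
have [->|fx] := eqVneq (phi x) 0; first by rewrite normr0 le_max lexx.
rewrite le_max (bM (M + 1)) ?orbT ?ltrDl//.
by exists x => //; exact: subset_closure.
Qed.

Lemma test_function_square_integrable phi : measurable Omega ->
  (lebesgue_rV d Omega < +oo)%E -> test_function Omega phi ->
  square_integrable (lebesgue_rV d) Omega phi.
Proof.
move=> mO Ooo tphi; have [M phiM] := test_function_bounded tphi.
have [sphi _ _] := tphi.
apply: (@square_integrable_bounded _ _ _ _ _ mO M) => //.
apply: measurable_funTS; apply: continuous_measurable_fun_rV.
exact: smooth_continuous.
Qed.

End test_functions.

(** * A smooth substitute for truncation at height one *)

Section outer_part.
Context {R : realType}.
Variable p : nat.
Implicit Types s a b : R.

Local Notation m := (p.+1.*2).

(** With [t = s ^+ m], this is [s] weighted by [t / (1 + t)]: as [p] grows it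
    tends to [0] for [|s| < 1] and to [s] for [|s| > 1].  Being rational it keeps
    test functions smooth; its derivative is nonnegative and bounded. *)
Definition outer_part s : R := s ^+ m.+1 / (1 + s ^+ m).

Definition outer_part' s : R :=
  s ^+ m * (m.+1%:R + s ^+ m) / (1 + s ^+ m) ^+ 2.

Lemma even_power_ge0 s : 0 <= s ^+ m.
Proof. by rewrite exprn_even_ge0// odd_double. Qed.

Lemma outer_part_denom_gt0 s : 0 < 1 + s ^+ m.
Proof. by rewrite ltr_pwDl// even_power_ge0. Qed.

Lemma is_derive_outer_part s : is_derive s 1 outer_part (outer_part' s).
Proof.
have D0 : 1 + s ^+ m != 0 by rewrite gt_eqF// outer_part_denom_gt0.
have Dn n : is_derive s 1 (fun t : R => t ^+ n.+1) (n.+1%:R * s ^+ n).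
  split; first exact: exprn_derivable.
  by rewrite exp_derive /GRing.scale/= mulr1.
have Dd : is_derive s 1 (fun t : R => 1 + t ^+ m) (m%:R * s ^+ m.-1).
  by have := is_deriveD (is_derive_cst (1 : R) s 1) (Dn m.-1); rewrite add0r.
have D := is_deriveM (Dn m) (@is_deriveV R (fun t : R => 1 + t ^+ m) s _ 1 D0 Dd).
suff <- : s ^+ m.+1 * (- (1 + s ^+ m) ^- 2 * (m%:R * s ^+ m.-1))
    + (1 + s ^+ m)^-1 * (m.+1%:R * s ^+ m) = outer_part' s by exact: D.
have sm : s ^+ m = s * s ^+ m.-1 by rewrite -exprS.
rewrite /outer_part' exprS -[m.+1]addn1 natrD; move: D0; rewrite sm => D0.
by field.
Qed.

Lemma outer_part'_ge0 s : 0 <= outer_part' s.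
Proof.
rewrite /outer_part' divr_ge0 ?sqr_ge0// mulr_ge0 ?even_power_ge0//.
by rewrite addr_ge0 ?even_power_ge0.
Qed.

Lemma outer_part'_le s : outer_part' s <= m.+1%:R.
Proof.
rewrite /outer_part' ler_pdivrMr ?exprn_gt0 ?outer_part_denom_gt0//.
set t := s ^+ m; have t0 : 0 <= t by exact: even_power_ge0.
have : (1 : R) <= m.+1%:R by rewrite ler1n.
by set c := m.+1%:R; nra.
Qed.

Lemma outer_part0 : outer_part 0 = 0.
Proof. by rewrite /outer_part exprS !mul0r. Qed.

Lemma norm_outer_part s : `|outer_part s| = `|s| * (s ^+ m / (1 + s ^+ m)).
Proof.
rewrite /outer_part exprS -mulrA normrM [X in _ * X]ger0_norm//.
by rewrite divr_ge0 ?even_power_ge0// ltW// outer_part_denom_gt0.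
Qed.

Lemma norm_outer_part_le s : `|outer_part s| <= `|s|.
Proof.
rewrite norm_outer_part ler_piMr// ler_pdivrMr ?outer_part_denom_gt0//.
by rewrite mul1r lerDr.
Qed.

Lemma outer_part_lipschitz a b :
  `|outer_part a - outer_part b| <= m.+1%:R * `|a - b|.
Proof.
wlog ab : a b / a <= b.
  by move=> H; case: (leP a b) => [|/ltW] /H//; rewrite distrC (distrC b).
have [c _ E] : exists2 c, c \in `[a, b]%R &
    outer_part b - outer_part a = outer_part' c * (b - a).
  apply: MVT_segment => // [s _|]; first exact: is_derive_outer_part.
  apply: derivable_within_continuous => s _.
  by apply: (@ex_derive _ _ _ _ _ _ _ (is_derive_outer_part s)).
rewrite distrC (distrC a) E normrM ler_wpM2r//.
by rewrite ger0_norm ?outer_part'_ge0 ?outer_part'_le.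
Qed.

(** On [|s| > 1] the weight [s ^+ m / (1 + s ^+ m)] is at least one half; on
    [|s| <= 1] one has [m.+1 * (1 - |s|) * |s| ^+ m <= 1 - |s| ^+ m.+1]. *)
Lemma outer_part_coercive s :
  2^-1 * (Num.max 0 (`|s| - 1)) ^+ 2 - m.+1%:R^-1 <=
  (`|s| - 1) * `|outer_part s|.
Proof.
have sE : s ^+ m = `|s| ^+ m.
  by rewrite -normrX ger0_norm// even_power_ge0.
rewrite norm_outer_part sE; set r : R := `|s|; set t : R := r ^+ m.
have r0 : 0 <= r by exact: normr_ge0.
have t0 : 0 <= t by exact: exprn_ge0.
have c0 : 0 < m.+1%:R^-1 :> R by rewrite invr_gt0.
have [r1|r1] := leP r 1.
  have -> : Num.max 0 (r - 1) = 0 by apply/max_idPl; rewrite subr_le0.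
  rewrite expr0n/= mulr0 sub0r -[leRHS]opprK lerN2 -mulNr opprB.
  have h : (1 - r) * t <= m.+1%:R^-1.
    rewrite -[leRHS]mul1r ler_pdivlMr//.
    apply: (@le_trans _ _ (1 - r ^+ m.+1)); last by rewrite gerBl exprn_ge0.
    rewrite -[leRHS]opprB subrX1 -mulNr opprB -mulrA ler_wpM2l ?subr_ge0//.
    rewrite mulr_natr -[X in _ *+ X](card_ord m.+1) -sumr_const.
    apply: ler_sum => i _.
    by apply: ler_wiXn2l => //; rewrite -ltnS.
  apply: le_trans h; rewrite ler_wpM2l ?subr_ge0//.
  apply: (@le_trans _ _ (1 * t)); last by rewrite mul1r.
  apply: ler_pM => //; first by rewrite divr_ge0// addr_ge0.
  by rewrite ler_pdivrMr ?ltr_pwDl// ler_peMr// lerDl.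
have -> : Num.max 0 (r - 1) = r - 1 by apply/max_idPr; rewrite subr_ge0 ltW.
have t1 : 1 <= t by rewrite exprn_ege1// ltW.
have h : 2^-1 <= t / (1 + t) by rewrite ler_pdivlMr; lra.
have : 2^-1 * (r - 1) ^+ 2 <= (r - 1) * (r * (t / (1 + t))).
  rewrite expr2 mulrCA ler_wpM2l ?subr_ge0 ?(ltW r1)//.
  by rewrite mulrC; apply: ler_pM; lra.
by move=> H; rewrite lerBlDr (le_trans H)// lerDl ltW.
Qed.

End outer_part.

Lemma test_function_outer_part (R : realType) (d : nat) (Omega : set 'rV[R]_d)
    (p : nat) (phi : 'rV[R]_d -> R) :
  test_function Omega phi -> test_function Omega (outer_part p \o phi).
Proof.
move=> tphi; have [sphi _ _] := tphi; apply: (test_function_sub tphi).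
  apply: smoothM; first exact: smoothX.
  apply: smoothV; last by move=> x; rewrite gt_eqF// outer_part_denom_gt0.
  by apply: smoothD; [exact: smooth_cst | exact: smoothX].
move=> x /= hx; apply: subset_closure => /=; apply: contra_neq hx => ->.
exact: outer_part0.
Qed.

(** * Weak derivatives and integration by parts *)

Section sobolev_theory.
Context {R : realType} {d : nat}.
Variable Omega : set 'rV[R]_d.
Hypothesis mOmega : measurable Omega.
Hypothesis Omega_lty : (lebesgue_rV d Omega < +oo)%E.
Implicit Types (u v w z : 'rV[R]_d -> R) (i : 'I_d).

Local Notation mu := (lebesgue_rV d).
Local Notation sqint := (square_integrable (lebesgue_rV d) Omega).

Lemma poweR2 (x : \bar R) : (0 <= x)%E -> (x `^ 2 = x ^+ 2)%E.
Proof.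
case: x => [r r0|_|//]; last by rewrite poweRyr ?expe2 ?mulyy ?pnatr_eq0.
by rewrite poweR_EFin powR_mulrn// EFin_expe.
Qed.

Lemma L2norm_sqr u :
  (L2norm Omega u ^+ 2 = \int[mu]_(x in Omega) (u x ^+ 2)%:E)%E.
Proof.
rewrite /L2norm -poweR2 ?Lnorm_ge0// poweR_Lnorm ?pnatr_eq0//.
rewrite [RHS]integral_mkcond; apply: eq_integral => x _.
rewrite poweR2 ?abse_ge0//= /patch; case: ifP => _ /=.
  by rewrite -EFinM -expr2 real_normK ?num_real.
by rewrite -[point]/(0 : R) -[RHS]/(0%:E) normr0 mul0e.
Qed.

Lemma inL2_square_integrable u : inL2 Omega u <-> sqint u.
Proof.
have E : (L2norm Omega u < +oo)%E <->
    (\int[mu]_(x in Omega) (u x ^+ 2)%:E < +oo)%E.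
  rewrite -L2norm_sqr; have := Lnorm_ge0 mu 2%:E (EFin \o (u \_ Omega)).
  rewrite -/(L2norm Omega u); case: (L2norm Omega u) => [r _|_|//].
    by rewrite -EFin_expe !ltry.
  by rewrite expe2 mulyy.
split=> [[mf] /E foo|[mf] /integrableP[_ foo]]; split => //.
  apply/integrableP; split.
    by apply/measurable_EFinP; exact: measurable_funX.
  by under eq_integral do rewrite gee0_abs ?lee_fin ?sqr_ge0//.
apply/E; move: foo.
by under eq_integral do rewrite gee0_abs ?lee_fin ?sqr_ge0//.
Qed.

Lemma cvg_L2norm0 (f : nat -> 'rV[R]_d -> R) : (forall k, sqint (f k)) ->
  L2norm Omega (f k) @[k --> \oo] --> 0%E ->
  \int[mu]_(x in Omega) (f k x ^+ 2) @[k --> \oo] --> (0 : R).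
Proof.
move=> sf f0.
have fin k : L2norm Omega (f k) \is a fin_num.
  rewrite ge0_fin_numE ?Lnorm_ge0//.
  by have /inL2_square_integrable[] := sf k.
have E k : \int[mu]_(x in Omega) (f k x ^+ 2) = fine (L2norm Omega (f k)) ^+ 2.
  by rewrite /Rintegral -L2norm_sqr -(fineK (fin k)) -EFin_expe.
have h : fine (L2norm Omega (f k)) @[k --> \oo] --> (0 : R) by exact: fine_cvg f0.
rewrite (_ : (fun k => _) = (fun k =>
    fine (L2norm Omega (f k)) * fine (L2norm Omega (f k)))); last first.
  by apply/funext => k; rewrite E expr2.
by rewrite -[X in _ --> X](mulr0 0); exact: cvgM.
Qed.

Lemma weak_partialP i u : sobolev Omega 1 u ->
  sqint (weak_partial Omega i u) /\
  is_weak_partial Omega i u (weak_partial Omega i u).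
Proof.
move=> [_ /(_ i)[g wg /= gL2]].
have [gL2' wg'] := xgetPex (cst 0) (ex_intro
  [set g | inL2 Omega g /\ is_weak_partial Omega i u g] g (conj gL2 wg)).
by split=> //; exact/inL2_square_integrable.
Qed.

(** Uniqueness of weak derivatives is avoided: a weak derivative [g] of [u] and
    the chosen one have the same integrals against the test functions, hence
    against their partial derivatives. *)
Lemma weak_partial2P i u : sobolev Omega 2 u ->
  sqint (weak_partial Omega i (weak_partial Omega i u)) /\
  is_weak_partial Omega i (weak_partial Omega i u)
    (weak_partial Omega i (weak_partial Omega i u)).
Proof.
move=> su; have s1 : sobolev Omega 1 u.
  by case: su => uL2 h; split=> // j; have [g wg [gL2 _]] := h j; exists g.
have [sv wv] := weak_partialP i s1.
case: su => _ /(_ i)[g wg [_ /(_ i)[h wh /= hL2]]].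
have wvh : is_weak_partial Omega i (weak_partial Omega i u) h.
  move=> phi tphi; rewrite -wh//.
  have tdphi := test_function_partial i tphi.
  by apply: oppr_inj; rewrite -(wv _ tdphi) -(wg _ tdphi).
have [wL2 ww] := xgetPex (cst 0) (ex_intro [set g | inL2 Omega g /\
  is_weak_partial Omega i (weak_partial Omega i u) g] h (conj hL2 wvh)).
by split=> //; exact/inL2_square_integrable.
Qed.

Lemma sobolev10_approx z : sobolev10 Omega z ->
  exists phi : nat -> 'rV[R]_d -> R,
  [/\ forall k, test_function Omega (phi k),
      \int[mu]_(x in Omega) ((phi k x - z x) ^+ 2) @[k --> \oo] --> (0 : R)
    & forall i, \int[mu]_(x in Omega)
        ((partial i (phi k) x - weak_partial Omega i z x) ^+ 2)
        @[k --> \oo] --> (0 : R)].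
Proof.
move=> [s1 [phi [tphi phiz dphiz]]]; exists phi; split => // [|i].
  apply: cvg_L2norm0 phiz => k; apply: square_integrableB => //.
    exact: test_function_square_integrable.
  by apply/inL2_square_integrable; case: s1.
apply: cvg_L2norm0 (dphiz i) => k; apply: square_integrableB => //.
  exact/test_function_square_integrable/test_function_partial.
by have [] := weak_partialP i s1.
Qed.

(** For a test function in place of [z] this is the definition of the weak
    derivative; both sides are continuous for convergence in [H^1]. *)
Lemma weak_integration_by_parts i v w z : sqint v -> sqint w ->
  is_weak_partial Omega i v w -> sobolev10 Omega z ->
  \int[mu]_(x in Omega) (w x * z x) =
  - \int[mu]_(x in Omega) (v x * weak_partial Omega i z x).
Proof.
move=> sv sw vw z10; have [phi [tphi phiz dphiz]] := sobolev10_approx z10.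
have sz : sqint z by apply/inL2_square_integrable; case: z10 => -[].
have [sdz _] := weak_partialP i z10.1.
have sphi k : sqint (phi k) by exact: test_function_square_integrable.
have sdphi k : sqint (partial i (phi k)).
  exact/test_function_square_integrable/test_function_partial.
have L1 := cvg_Rintegral_mul mOmega sphi sz sw phiz.
have L2 := cvgN (cvg_Rintegral_mul mOmega sdphi sdz sv (dphiz i)).
under eq_Rintegral do rewrite mulrC.
under [in RHS]eq_Rintegral do rewrite mulrC.
have E : (fun k => \int[mu]_(x in Omega) (phi k x * w x)) =
    (fun k => - \int[mu]_(x in Omega) (partial i (phi k) x * v x)).
  apply/funext => k; apply: oppr_inj; rewrite opprK.
  under eq_Rintegral do rewrite mulrC.
  under [in RHS]eq_Rintegral do rewrite mulrC.
  by rewrite (vw _ (tphi k)).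
by rewrite E in L1; exact: (cvg_unique _ L1 (L2 _)).
Qed.

(** [G o phi] is an admissible test function when [phi] is one; the polarization
    [- G' v (d phi) <= G' (d phi - v) ^+ 2 / 2] gives the sign in the limit
    without a chain rule for [G o z]. *)
Lemma integral_weak_partial2_outer_part_le0 (p : nat) i z w :
  sqint w -> is_weak_partial Omega i (weak_partial Omega i z) w ->
  sobolev10 Omega z ->
  \int[mu]_(x in Omega) (w x * outer_part p (z x)) <= 0.
Proof.
set v := weak_partial Omega i z => sw vw z10.
have [phi [tphi phiz dphiz]] := sobolev10_approx z10.
have sz : sqint z by apply/inL2_square_integrable; case: z10 => -[].
have [sdz _] : sqint v /\ _ := weak_partialP i z10.1.
have sphi k : sqint (phi k) by exact: test_function_square_integrable.
have sdphi k : sqint (partial i (phi k)).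
  exact/test_function_square_integrable/test_function_partial.
have scale (a : R) (s : nat -> R) :
    s k @[k --> \oo] --> 0 -> a * s k @[k --> \oo] --> 0.
  by move=> h; rewrite -[X in _ --> X](mulr0 a); apply: cvgM h; exact: cvg_cst.
pose G := @outer_part R p; pose c : R := p.+1.*2.+1%:R.
have sGphi k : sqint (G \o phi k).
  exact/test_function_square_integrable/test_function_outer_part.
have cG : continuous G.
  move=> s; apply: differentiable_continuous; apply/derivable1_diffP.
  by apply: (@ex_derive _ _ _ _ _ _ _ (is_derive_outer_part p s)).
have sGz : sqint (G \o z).
  apply: (square_integrable_dominated mOmega _ _ sz) => [|x _].
    apply: (measurableT_comp _ sz.1); exact: continuous_measurable_fun.
  exact: norm_outer_part_le.
have Gphiz : \int[mu]_(x in Omega) (((G \o phi k) x - (G \o z) x) ^+ 2)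
    @[k --> \oo] --> (0 : R).
  have U := scale (c ^+ 2) _ phiz.
  apply: (squeeze_cvgr _ (cvg_cst 0) U); apply: nearW => k.
  apply/andP; split; first by apply: Rintegral_ge0 => x _; exact: sqr_ge0.
  have s1 := square_integrableB mOmega (sphi k) sz.
  rewrite -RintegralZl//; last exact: s1.2.
  apply: le_Rintegral => //.
  - exact: (square_integrableB mOmega (sGphi k) sGz).2.
  - exact: (integrableZl mOmega (c ^+ 2) s1.2).
  move=> x _; rewrite -[leLHS]real_normK ?num_real//.
  rewrite -[(phi k x - _) ^+ 2]real_normK ?num_real// -exprMn.
  by rewrite lerXn2r ?nnegrE ?mulr_ge0//; exact: outer_part_lipschitz.
have L1 := cvg_Rintegral_mul mOmega sGphi sGz sw Gphiz.
have L2 := scale (c / 2) _ (dphiz i).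
under eq_Rintegral do rewrite mulrC.
apply: (ler_cvg_to L1 L2); apply: nearW => k.
under eq_Rintegral do rewrite mulrC.
have tG := test_function_outer_part p (tphi k).
rewrite -[leLHS]opprK -(vw _ tG).
have s1 := square_integrableB mOmega (sdphi k) sdz.
have sdG : sqint (partial i (G \o phi k)).
  exact/test_function_square_integrable/test_function_partial.
rewrite -mulN1r -!RintegralZl//; [|exact: square_integrable_mul|exact: s1.2].
apply: le_Rintegral => //.
- exact: (integrableZl mOmega (-1) (square_integrable_mul mOmega sdz sdG)).
- exact: (integrableZl mOmega (c / 2) s1.2).
move=> x _; rewrite (partial_comp i _ (is_derive_outer_part p (phi k x))).
  have := outer_part'_ge0 p (phi k x); have := outer_part'_le p (phi k x).
  rewrite -/c -/v; move: (outer_part' p _) (partial i _ x) (v x) => g a b gc g0.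
  have := mulr_ge0 g0 (addr_ge0 (sqr_ge0 a) (sqr_ge0 b)).
  have : 0 <= (c - g) * (a - b) ^+ 2 by rewrite mulr_ge0 ?sqr_ge0// subr_ge0.
  rewrite !expr2; lra.
by apply: smooth_differentiable; have [] := tphi k.
Qed.

End sobolev_theory.

(** * Maximum bound *)

Section maximum_bound.
Context {R : realType} {d : nat}.
Variable Omega : set 'rV[R]_d.
Hypothesis mOmega : measurable Omega.
Hypothesis Omega_lty : (lebesgue_rV d Omega < +oo)%E.

Local Notation mu := (lebesgue_rV d).

(** With [h = A u - kappa Lap u] and [G = outer_part p u], the bound [|h| <= A]
    gives [A (|u| - 1) |G| <= (A u - h) G = kappa (Lap u) G], whose integral is at
    most [0].  By coercivity of [outer_part] the integral of [(max 0 (|u| - 1))^2]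
    is at most a constant times [1 / (2 p + 3)], for every [p]. *)
Lemma elliptic_maximum_bound (A kappa : R) (u : 'rV[R]_d -> R) :
  0 < A -> 0 <= kappa -> sobolev Omega 2 u -> sobolev10 Omega u ->
  {ae mu, forall x, Omega x -> `|A * u x - kappa * laplacian Omega u x| <= A} ->
  {ae mu, forall x, Omega x -> `|u x| <= 1}.
Proof.
move=> A0 k0 u2 u10 bound.
have su : square_integrable mu Omega u.
  by apply/inL2_square_integrable; case: u2.
pose w i := weak_partial Omega i (weak_partial Omega i u).
have sw i : square_integrable mu Omega (w i).
  by have [] := weak_partial2P i u2.
pose M x : R := Num.max 0 (`|u x| - 1).
have mM : measurable_fun Omega M.
  apply: measurable_maxr => //; apply: measurable_funB => //.
  by apply: measurableT_comp su.1.
have sM : square_integrable mu Omega M.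
  apply: (square_integrable_dominated mOmega mM _ su) => x _.
  rewrite ger0_norm ?le_max ?lexx// ge_max normr_ge0/= gerBl//.
set I := \int[mu]_(x in Omega) (M x ^+ 2).
have I_le p (c : R) : c = p.+1.*2.+1%:R^-1 ->
    A * (2^-1 * I) <= A * (c * fine (mu Omega)).
  move=> cE; have c0 : 0 <= c by rewrite cE invr_ge0.
  pose G x := outer_part p (u x).
  have sG : square_integrable mu Omega G.
    apply: (square_integrable_dominated mOmega _ _ su) => [|x _].
      apply: (measurableT_comp _ su.1); apply: continuous_measurable_fun => s.
      apply: differentiable_continuous; apply/derivable1_diffP.
      by apply: (@ex_derive _ _ _ _ _ _ _ (is_derive_outer_part p s)).
    exact: norm_outer_part_le.
  have iM : mu.-integrable Omega (EFin \o (fun x => 2^-1 * M x ^+ 2)).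
    exact: (integrableZl mOmega 2^-1 sM.2).
  have ic : mu.-integrable Omega (EFin \o cst c).
    apply: (integrable_ae_bounded mOmega (M := c)) => //.
    by apply: aeW => x _; rewrite ger0_norm.
  have iMc : mu.-integrable Omega (EFin \o (fun x => 2^-1 * M x ^+ 2 - c)).
    exact: (integrableB mOmega iM ic).
  have iwG i := square_integrable_mul mOmega (sw i) sG.
  have iS := integrable_sumR mOmega (index_enum 'I_d) iwG.
  have le1 : \int[mu]_(x in Omega) (A * (2^-1 * M x ^+ 2 - c))
      <= \int[mu]_(x in Omega) (kappa * \sum_i w i x * G x).
    apply: ae_le_Rintegral => //.
    - exact: (integrableZl mOmega A iMc).
    - exact: (integrableZl mOmega kappa iS).
    apply: filterS bound => x h Ox.
    have := outer_part_coercive p (u x); rewrite -cE => coer.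
    apply: (le_trans (ler_wpM2l (ltW A0) coer)).
    rewrite -mulr_suml -/(laplacian Omega u x) -/(G x).
    have uG : u x * G x = `|u x| * `|G x|.
      rewrite /G norm_outer_part mulrA -expr2 real_normK ?num_real//.
      by rewrite /outer_part exprS; ring.
    have hG : (A * u x - kappa * laplacian Omega u x) * G x <= A * `|G x|.
      by rewrite (le_trans (ler_norm _))// normrM ler_wpM2r ?h.
    rewrite mulrBl -mulrA uG in hG; lra.
  move: le1; rewrite (RintegralZl A mOmega iMc) (RintegralZl kappa mOmega iS).
  rewrite (RintegralB mOmega iM ic) (RintegralZl 2^-1 mOmega sM.2).
  rewrite Rintegral_cst// -/I Rintegral_sum// => le1.
  have : \sum_i \int[mu]_(x in Omega) (w i x * G x) <= 0.
    apply: sumr_le0 => i _; have [_ wi] := weak_partial2P i u2.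
    exact: (integral_weak_partial2_outer_part_le0 _ _ _ (sw i) wi u10).
  move=> /(ler_wpM2l k0); rewrite mulr0 => le2.
  by have := le_trans le1 le2; rewrite mulrBr subr_le0.
have I0 : I <= 0.
  (* if [0 < I], an index [p] above the volume over [I] contradicts [I_le] *)
  rewrite leNgt; apply/negP => I0.
  have V0 : 0 <= fine (mu Omega) by exact: fine_ge0.
  have hb := archi_boundP (divr_ge0 V0 (ltW I0)).
  have := I_le (Num.bound (fine (mu Omega) / I)) _ erefl.
  rewrite ler_pM2l// mulrC ler_pdivlMl ?ltr0n//.
  apply/negP; rewrite -ltNge.
  move: hb; rewrite ltr_pdivrMr//; set b := Num.bound _ => hb.
  apply: (lt_trans hb).
  have -> : b.+1.*2.+1%:R = 2 * b%:R + 3 :> R.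
    by rewrite -addn1 -muln2 natrD natrM -addn1 natrD; ring.
  have : 0 <= b%:R :> R by [].
  nra.
have := Rintegral_eq0_ae mOmega sM.2 (fun x _ => sqr_ge0 (M x)) I0.
apply: filterS => x h Ox; have /eqP := h Ox.
rewrite sqrf_eq0 /M => /eqP Mx.
by rewrite -subr_le0 -Mx le_max lexx orbT.
Qed.

End maximum_bound.

(** * The double-well nonlinearity *)

Section double_well.
Context {R : realType}.
Implicit Types a b S : R.

Lemma F_dw_ge0 a : 0 <= F_dw a.
Proof. by rewrite /F_dw mulr_ge0// sqr_ge0. Qed.

Lemma F_dw_le a : `|a| <= 1 -> F_dw a <= 4^-1.
Proof.
rewrite ler_norml /F_dw => /andP[a1 a2]; rewrite ler_piMr//.
have : 0 <= a ^+ 2 by exact: sqr_ge0.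
have : a ^+ 2 <= 1 by rewrite expr2; nra.
by set t := a ^+ 2; rewrite expr2; nra.
Qed.

(** Taylor expansion, [F''] being at most 2 on [-1, 1]. *)
Lemma F_dw_increment a b : `|a| <= 1 -> `|b| <= 1 ->
  F_dw a - F_dw b <= f_dw b * (a - b) + (a - b) ^+ 2.
Proof.
rewrite !ler_norml => /andP[a1 a2] /andP[b1 b2].
rewrite -subr_ge0 (_ : _ - _ =
  (a - b) ^+ 2 * ((6 - 3 * b ^+ 2 - 2 * (a * b) - a ^+ 2) / 4)); last first.
  by rewrite /F_dw /f_dw; field.
rewrite mulr_ge0 ?sqr_ge0// divr_ge0// !expr2; nra.
Qed.

(** [S * a - f a] is nondecreasing on [-1, 1] and equals [S] at [1]. *)
Lemma stabilized_f_dw_bound S a : 2 <= S -> `|a| <= 1 -> `|S * a - f_dw a| <= S.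
Proof.
move=> S2; rewrite !ler_norml /f_dw => /andP[a1 a2].
have h1 : 0 <= (1 - a) * (S - a - a ^+ 2).
  by apply: mulr_ge0; rewrite ?expr2; nra.
have h2 : 0 <= (1 + a) * (S + a - a ^+ 2).
  by apply: mulr_ge0; rewrite ?expr2; nra.
rewrite (_ : (1 - a) * _ = S - (S * a - (a ^+ 3 - a))) in h1; last by ring.
rewrite (_ : (1 + a) * _ = S + (S * a - (a ^+ 3 - a))) in h2; last by ring.
by apply/andP; split; lra.
Qed.

End double_well.

(** * The L1 implicit-explicit scheme *)

Section scheme_at_a_point.
Context {R : realType}.
Variables (b : nat -> R) (gamma eps S : R).
Hypothesis b_ge0 : forall k, 0 <= b k.
Hypothesis b_nonincreasing : forall k, b k.+1 <= b k.
Hypothesis b_convex : forall k, b k.+1 - b k.+2 <= b k - b k.+1.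
Hypothesis gamma_gt0 : 0 < gamma.
Hypothesis S_ge2 : 2 <= S.

Variables (a : nat -> R) (n : nat) (Lap : R).
Hypothesis scheme : memory_sum b n.+1 (fun k => a n.+1 - a k) =
  gamma * (eps ^+ 2 * Lap - f_dw (a n) - S * (a n.+1 - a n)).

(** Moving the terms in [a n.+1] to the left leaves a combination of earlier
    values with nonnegative weights of sum [b 0], plus [gamma * (S * a n - f (a n))]. *)
Lemma scheme_rhs_bound : (forall k, (k <= n)%N -> `|a k| <= 1) ->
  `|(b 0%N + gamma * S) * a n.+1 - (gamma * eps ^+ 2) * Lap| <= b 0%N + gamma * S.
Proof.
move=> a1; move: scheme; rewrite memory_sumB memory_sum_cst => sch.
rewrite (_ : _ - _ = memory_sum b n.+1 a + gamma * (S * a n - f_dw (a n)));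
  last by lra.
apply: (le_trans (ler_normD _ _)); apply: lerD; last first.
  by rewrite normrM gtr0_norm// ler_wpM2l ?(ltW gamma_gt0)//
    stabilized_f_dw_bound ?a1.
have ak k : (k < n.+1)%N || (k == 0)%N -> -1 <= a k <= 1.
  by move=> /orP[|/eqP ->]; rewrite ?ltnS -ler_norml => *; exact: a1.
have up := le_memory_sum b_ge0 b_nonincreasing (n := n.+1) (g := a) (h := fun=> 1).
have lo := le_memory_sum b_ge0 b_nonincreasing (n := n.+1) (g := fun=> -1) (h := a).
rewrite memory_sum_cst in up; rewrite memory_sum_cst in lo.
rewrite ler_norml -mulrN1 lo; last by move=> k /ak /andP[].
by rewrite -[leRHS]mulr1 up// => k /ak /andP[].
Qed.

Lemma scheme_energy_density : `|a n| <= 1 -> `|a n.+1| <= 1 ->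
  F_dw (a n.+1) + (2 * gamma)^-1 *
    memory_sum b n.+1 (fun k => (a n.+1 - a k) ^+ 2) <=
  F_dw (a n) + (2 * gamma)^-1 * memory_sum b n (fun k => (a n - a k) ^+ 2)
  + eps ^+ 2 * (Lap * a n.+1 - Lap * a n).
Proof.
move=> an an1; have dF := F_dw_increment an1 an.
have := memory_sum_energy b_ge0 b_nonincreasing b_convex n a; rewrite scheme.
set Q1 := memory_sum b n.+1 _; set Q0 := memory_sum b n _.
move=> dQ; have g2 : 0 < (2 * gamma)^-1 by rewrite invr_gt0 mulr_gt0.
have {}dQ : (2 * gamma)^-1 * (Q1 - Q0) <=
    (eps ^+ 2 * Lap - f_dw (a n) - S * (a n.+1 - a n)) * (a n.+1 - a n).
  rewrite mulrC ler_pdivrMr ?mulr_gt0//; lra.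
have S1 : 0 <= S - 1 by rewrite subr_ge0 (le_trans _ S_ge2)// ler1n.
have := mulr_ge0 S1 (sqr_ge0 (a n.+1 - a n)).
move: dF dQ; rewrite !expr2 mulrBr; lra.
Qed.

End scheme_at_a_point.

(** * Energy dissipation *)

Section energy_dissipation.
Context {R : realType} {d : nat}.
Variable Omega : set 'rV[R]_d.
Hypothesis mOmega : measurable Omega.
Hypothesis Omega_lty : (lebesgue_rV d Omega < +oo)%E.
Implicit Types (u v : 'rV[R]_d -> R).

Local Notation mu := (lebesgue_rV d).
Local Notation sqint := (square_integrable (lebesgue_rV d) Omega).

Definition dirichlet u : R :=
  \sum_(i < d) \int[mu]_(x in Omega) (weak_partial Omega i u x ^+ 2).

(** Finite value of the modified energy.  Its memory term vanishes for [n = 0],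
    where [memory_sum] reduces to the distance from [u 0] to itself. *)
Definition real_energy (b : nat -> R) (gamma eps : R)
    (u : nat -> 'rV[R]_d -> R) (n : nat) : R :=
  eps ^+ 2 / 2 * dirichlet (u n) + \int[mu]_(x in Omega) F_dw (u n x)
  + (2 * gamma)^-1 * memory_sum b n
      (fun k => \int[mu]_(x in Omega) ((u n x - u k x) ^+ 2)).

Lemma sobolev2_square_integrable u : sobolev Omega 2 u -> sqint u.
Proof. by move=> u2; apply/inL2_square_integrable; case: u2. Qed.

Lemma integrable_F_dw u : sqint u ->
  {ae mu, forall x, Omega x -> `|u x| <= 1} ->
  mu.-integrable Omega (EFin \o (fun x => F_dw (u x))).
Proof.
move=> su u1; apply: (integrable_ae_bounded mOmega (M := 4^-1)) => //.
  apply: measurable_funM => //; apply: measurable_funX.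
  by apply: measurable_funB => //; apply: measurable_funX; exact: su.1.
apply: filterS u1 => x h Ox; rewrite ger0_norm ?F_dw_ge0//.
by apply: F_dw_le; exact: h.
Qed.

Lemma integrable_laplacian_mul u v : sobolev Omega 2 u -> sqint v ->
  mu.-integrable Omega (EFin \o (fun x => laplacian Omega u x * v x)).
Proof.
move=> u2 sv; apply: square_integrable_mul => //.
apply: square_integrable_sum => // i.
by have [] := weak_partial2P i u2.
Qed.

Lemma laplacian_integration_by_parts u v : sobolev Omega 2 u ->
  sobolev10 Omega u -> sobolev10 Omega v ->
  \int[mu]_(x in Omega) (laplacian Omega u x * v x) =
  - \sum_(i < d) \int[mu]_(x in Omega)
      (weak_partial Omega i u x * weak_partial Omega i v x).
Proof.
move=> u2 u10 v10.
have sv : sqint v by apply/inL2_square_integrable; case: v10 => -[].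
have sw i := (weak_partial2P i u2).1.
transitivity (\int[mu]_(x in Omega) \sum_(i < d)
    (weak_partial Omega i (weak_partial Omega i u) x * v x)).
  by apply: eq_Rintegral => x _; rewrite /laplacian mulr_suml.
rewrite -sumrN.
rewrite Rintegral_sum//; last by move=> i; exact: square_integrable_mul.
apply: eq_bigr => i _.
have [su' _] := weak_partialP i u10.1.
exact: (weak_integration_by_parts _ _ su' (sw i) (weak_partial2P i u2).2 v10).
Qed.

(** [g . (g - h) >= (|g|^2 - |h|^2) / 2] for the gradients. *)
Lemma dirichlet_increment u v : sobolev Omega 2 u -> sobolev10 Omega u ->
  sobolev10 Omega v ->
  \int[mu]_(x in Omega) (laplacian Omega u x * u x)
  - \int[mu]_(x in Omega) (laplacian Omega u x * v x) <=
  (dirichlet v - dirichlet u) / 2.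
Proof.
move=> u2 u10 v10; rewrite !laplacian_integration_by_parts// opprK addrC.
have sums (A B C D : 'I_d -> R) : (forall i, A i - B i <= (C i - D i) / 2) ->
    \sum_i A i - \sum_i B i <= (\sum_i C i - \sum_i D i) / 2.
  by move=> h; rewrite -!sumrB mulr_suml; apply: ler_sum => i _; exact: h.
apply: sums => i.
have [su _] := weak_partialP i u10.1; have [sv _] := weak_partialP i v10.1.
move: (weak_partial Omega i u) (weak_partial Omega i v) su sv => g h sg sh.
have igh := square_integrable_mul mOmega sg sh.
have : 0 <= \int[mu]_(x in Omega) ((g x - h x) ^+ 2).
  by apply: Rintegral_ge0 => x _; exact: sqr_ge0.
have i2 : mu.-integrable Omega (EFin \o (fun x => 2 * (g x * h x))).
  exact: (integrableZl mOmega 2 igh).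
have i3 : mu.-integrable Omega (EFin \o (fun x => g x ^+ 2 - 2 * (g x * h x))).
  exact: (integrableB mOmega sg.2 i2).
under eq_Rintegral do rewrite sqrrB -mulr_natl.
rewrite (RintegralD mOmega i3 sh.2) (RintegralB mOmega sg.2 i2).
rewrite (RintegralZl 2 mOmega igh).
have -> : \int[mu]_(x in Omega) (g x * g x) = \int[mu]_(x in Omega) (g x ^+ 2).
  by apply: eq_Rintegral => x _; rewrite expr2.
lra.
Qed.

Lemma integrable_memory_sum (b : nat -> R) n (u : nat -> 'rV[R]_d -> R) v :
  sqint v -> (forall k, (k <= n)%N -> sqint (u k)) ->
  mu.-integrable Omega (EFin \o
    (fun x => memory_sum b n (fun k => (v x - u k x) ^+ 2))) /\
  \int[mu]_(x in Omega) memory_sum b n (fun k => (v x - u k x) ^+ 2) =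
  memory_sum b n (fun k => \int[mu]_(x in Omega) ((v x - u k x) ^+ 2)).
Proof.
(* only the indices up to [n] occur in the sum, so [u] may be frozen after [n] *)
move=> sv; wlog su : u / forall k, sqint (u k).
  move=> H su; have {H} := H (fun k => u (minn k n)).
  have E : (fun x => memory_sum b n (fun k => (v x - u (minn k n) x) ^+ 2)) =
      (fun x => memory_sum b n (fun k => (v x - u k x) ^+ 2)).
    by apply/funext => x; apply: eq_memory_sum => k /minn_idPl ->.
  rewrite E => H; have [k|k _|I1 I2] := H; try by apply: su; exact: geq_minr.
  by split=> //; rewrite I2; apply: eq_memory_sum => k /minn_idPl ->.
move=> _; have sB k := square_integrableB mOmega sv (su k).
have iZ (c : R) k :
    mu.-integrable Omega (EFin \o (fun x => c * (v x - u k x) ^+ 2)).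
  exact: (integrableZl mOmega c (sB k).2).
have iS := integrable_sumR mOmega (index_iota 1 n)
  (fun k => iZ (b (n - k - 1)%N - b (n - k)%N) k).
split; first exact: (integrableD mOmega iS (iZ (b (n - 1)%N) 0%N)).
rewrite /memory_sum (RintegralD mOmega iS (iZ _ 0%N)).
rewrite Rintegral_sum// (RintegralZl _ mOmega (sB 0%N).2); congr (_ + _).
by apply: eq_bigr => k _; rewrite (RintegralZl _ mOmega (sB k).2).
Qed.

Lemma energyE (eps : R) u : sobolev Omega 2 u ->
  sobolev10 Omega u -> {ae mu, forall x, Omega x -> `|u x| <= 1} ->
  energy Omega eps u =
  (eps ^+ 2 / 2 * dirichlet u + \int[mu]_(x in Omega) F_dw (u x))%:E.
Proof.
move=> u2 u10 u1; have su := sobolev2_square_integrable u2.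
have iF := integrable_F_dw su u1.
have sv i := (weak_partialP i u10.1).1.
have iG := integrable_sumR mOmega (index_enum 'I_d) (fun i => (sv i).2).
have iZ : mu.-integrable Omega
    (EFin \o (fun x => eps ^+ 2 / 2 * sqr_norm_grad Omega u x)).
  exact: (integrableZl mOmega (eps ^+ 2 / 2) iG).
have iE : mu.-integrable Omega (EFin \o (fun x =>
    eps ^+ 2 / 2 * sqr_norm_grad Omega u x + F_dw (u x))).
  exact: (integrableD mOmega iZ iF).
rewrite /energy -(fineK (integrable_fin_num mOmega iE)); congr EFin.
rewrite -[LHS]/(Rintegral mu Omega _) (RintegralD mOmega iZ iF).
rewrite (RintegralZl _ mOmega iG) /dirichlet -Rintegral_sum// => i.
exact: (sv i).2.
Qed.

Lemma L2norm_sqrE u : sqint u ->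
  (L2norm Omega u ^+ 2 = (\int[mu]_(x in Omega) (u x ^+ 2))%:E)%E.
Proof.
by move=> su; rewrite L2norm_sqr /Rintegral fineK// (integrable_fin_num mOmega su.2).
Qed.

Lemma modified_energyE (alpha gamma eps dt : R) (u : nat -> 'rV[R]_d -> R) n :
  (forall k, (k <= n)%N -> sobolev Omega 2 (u k)) -> sobolev10 Omega (u n) ->
  {ae mu, forall x, Omega x -> `|u n x| <= 1} ->
  modified_energy Omega alpha gamma eps dt u n =
  (real_energy (L1coef alpha dt) gamma eps u n)%:E.
Proof.
move=> u2 u10 u1; rewrite /modified_energy /real_energy.
have su k : (k <= n)%N -> sqint (u k).
  by move=> kn; exact/sobolev2_square_integrable/u2.
have sB k : (k <= n)%N -> sqint (u n \- u k).
  by move=> kn; exact: (square_integrableB mOmega (su _ (leqnn n)) (su k kn)).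
rewrite (energyE eps (u2 n (leqnn n)) u10 u1).
case: n u2 u10 u1 su sB => [|n] u2 u10 u1 su sB.
  rewrite eqxx (energyE eps (u2 0%N isT) u10 u1); congr EFin.
  rewrite /memory_sum big_geq// add0r.
  have -> : \int[mu]_(x in Omega) ((u 0%N x - u 0%N x) ^+ 2) = 0.
    rewrite -[RHS](mul0r (fine (mu Omega))) -Rintegral_cst//.
    by apply: eq_Rintegral => x _; rewrite subrr expr0n.
  by rewrite !mulr0 addr0.
rewrite [_ == _]/= (L2norm_sqrE (sB 0%N isT)) big_nat.
under eq_bigr => k /andP[_ kn] do rewrite (L2norm_sqrE (sB k (ltnW kn))) -EFinM.
rewrite sumEFin -!EFinM -!EFinD; congr EFin.
by rewrite /memory_sum [in RHS]big_nat !div1r; ring.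
Qed.

End energy_dissipation.

Lemma Linftynorm_le1 (R : realType) (d : nat) (Omega : set 'rV[R]_d)
    (v : 'rV[R]_d -> R) : (Linftynorm Omega v <= 1)%E ->
  {ae lebesgue_rV d, forall x, Omega x -> `|v x| <= 1}.
Proof.
rewrite /Linftynorm unlock; case: ifPn => [_ /ess_supP|mu0 _].
  apply: filterS => x /=; rewrite lee_fin /patch => + Ox.
  by rewrite mem_set.
exists setT; split => //.
by apply/eqP; rewrite -measure_le0 leNgt.
Qed.

Section scheme_on_domain.
Context {R : realType} {d : nat}.
Variable Omega : set 'rV[R]_d.
Hypothesis mOmega : measurable Omega.
Hypothesis Omega_lty : (lebesgue_rV d Omega < +oo)%E.
Variables (alpha gamma eps S dt : R) (N : nat) (u : nat -> 'rV[R]_d -> R).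
Hypothesis halpha : 0 < alpha < 1.
Hypothesis gamma_gt0 : 0 < gamma.
Hypothesis S_ge2 : 2 <= S.
Hypothesis u2 : forall n, (n <= N)%N -> sobolev Omega 2 (u n).
Hypothesis u10 : forall n, (n <= N)%N -> sobolev10 Omega (u n).
Hypothesis u0_le1 : {ae lebesgue_rV d, forall x, Omega x -> `|u 0%N x| <= 1}.
Hypothesis scheme : forall n, (1 <= n <= N)%N ->
  {ae lebesgue_rV d, forall x, Omega x ->
    L1deriv alpha dt u n x =
    gamma * (eps ^+ 2 * laplacian Omega (u n) x - f_dw (u n.-1 x)
             - S * (u n x - u n.-1 x))}.

Local Notation mu := (lebesgue_rV d).
Local Notation b := (L1coef alpha dt).

Let b_ge0 k : 0 <= b k.
Proof. by apply: L1coef_ge0; case/andP: halpha. Qed.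

Let b_nonincreasing k : b k.+1 <= b k.
Proof. exact: L1coef_nonincreasing. Qed.

Let b_convex k : b k.+1 - b k.+2 <= b k - b k.+1.
Proof. exact: L1coef_convex. Qed.

Lemma scheme_memory_sum n : (n < N)%N ->
  {ae mu, forall x, Omega x ->
    memory_sum b n.+1 (fun k => u n.+1 x - u k x) =
    gamma * (eps ^+ 2 * laplacian Omega (u n.+1) x - f_dw (u n x)
             - S * (u n.+1 x - u n x))}.
Proof.
move=> nN; apply: filterS (scheme (n := n.+1) nN) => x h Ox.
by rewrite -(h Ox) /L1deriv -(memory_sumE b (fun k => u k x)).
Qed.

(** Induction on the time step: bounds on the earlier values turn the scheme into
    an elliptic problem to which the maximum principle applies. *)
Lemma discrete_maximum_bound n : (n <= N)%N ->
  {ae mu, forall x, Omega x -> `|u n x| <= 1}.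
Proof.
elim/ltn_ind: n => -[//|n] IH nN.
have A0 : 0 < b 0%N + gamma * S.
  by rewrite ltr_wpDl// mulr_gt0// (lt_le_trans _ S_ge2).
have k0 : 0 <= gamma * eps ^+ 2 by rewrite mulr_ge0 ?sqr_ge0 ?(ltW gamma_gt0).
apply: (elliptic_maximum_bound mOmega Omega_lty A0 k0 (u2 nN) (u10 nN)).
have prev : {ae mu, forall x, forall k, (k <= n)%N -> Omega x -> `|u k x| <= 1}.
  apply: ae_foralln => k; have [kn|nk] := leqP k n; last first.
    by apply: aeW => x.
  by apply: filterS (IH k kn (leq_trans (leqW kn) nN)) => x h _.
apply: filterS2 prev (scheme_memory_sum nN) => x h sch Ox.
apply: (scheme_rhs_bound b_ge0 b_nonincreasing gamma_gt0 S_ge2 (sch Ox)).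
by move=> k kn; exact: h.
Qed.

Lemma real_energy_nonincreasing n : (n < N)%N ->
  real_energy Omega b gamma eps u n.+1 <= real_energy Omega b gamma eps u n.
Proof.
move=> nN; have nN' := ltnW nN.
have su k : (k <= N)%N -> square_integrable mu Omega (u k).
  by move=> kN; exact/sobolev2_square_integrable/u2.
have iF k : (k <= N)%N ->
    mu.-integrable Omega (EFin \o (fun x => F_dw (u k x))).
  by move=> kN; apply: integrable_F_dw (su k kN) (discrete_maximum_bound kN).
have [iQ1 Q1E] := integrable_memory_sum mOmega b (su _ nN)
  (fun k kn => su k (leq_trans kn nN)).
have [iQ0 Q0E] := integrable_memory_sum mOmega b (su _ nN')
  (fun k kn => su k (leq_trans kn nN')).
have iD1 := integrable_laplacian_mul mOmega (u2 nN) (su _ nN).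
have iD0 := integrable_laplacian_mul mOmega (u2 nN) (su _ nN').
pose D x := laplacian Omega (u n.+1) x * u n.+1 x - laplacian Omega (u n.+1) x * u n x.
have iD : mu.-integrable Omega (EFin \o D) by exact: (integrableB mOmega iD1 iD0).
pose density m x := F_dw (u m x)
  + (2 * gamma)^-1 * memory_sum b m (fun k => (u m x - u k x) ^+ 2).
have iZ1 := integrableZl mOmega (2 * gamma)^-1 iQ1.
have iZ0 := integrableZl mOmega (2 * gamma)^-1 iQ0.
have i1 : mu.-integrable Omega (EFin \o density n.+1).
  exact: (integrableD mOmega (iF _ nN) iZ1).
have i0 : mu.-integrable Omega (EFin \o density n).
  exact: (integrableD mOmega (iF _ nN') iZ0).
have iZD : mu.-integrable Omega (EFin \o (fun x => eps ^+ 2 * D x)).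
  exact: (integrableZl mOmega (eps ^+ 2) iD).
have le_density : \int[mu]_(x in Omega) density n.+1 x <=
    \int[mu]_(x in Omega) (density n x + eps ^+ 2 * D x).
  apply: ae_le_Rintegral => //; first exact: (integrableD mOmega i0 iZD).
  have A1 := discrete_maximum_bound nN; have A0 := discrete_maximum_bound nN'.
  apply: filterS3 (scheme_memory_sum nN) A1 A0 => x sch h1 h0 Ox.
  exact: (scheme_energy_density b_ge0 b_nonincreasing b_convex gamma_gt0 S_ge2
    (sch Ox) (h0 Ox) (h1 Ox)).
move: le_density; rewrite (RintegralD mOmega i0 iZD) (RintegralZl _ mOmega iD).
rewrite (RintegralD mOmega (iF _ nN) iZ1) (RintegralD mOmega (iF _ nN') iZ0).
rewrite (RintegralZl _ mOmega iQ1) (RintegralZl _ mOmega iQ0) Q1E Q0E.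
rewrite (RintegralB mOmega iD1 iD0).
have := dirichlet_increment mOmega Omega_lty (u2 nN) (u10 nN) (u10 nN').
have arith (L1 L0 D1 D0 F1 F0 Q1 Q0 g : R) : L1 - L0 <= (D0 - D1) / 2 ->
    F1 + g * Q1 <= F0 + g * Q0 + eps ^+ 2 * (L1 - L0) ->
    eps ^+ 2 / 2 * D1 + F1 + g * Q1 <= eps ^+ 2 / 2 * D0 + F0 + g * Q0.
  by move=> /(ler_wpM2l (sqr_ge0 eps)); lra.
exact: arith.
Qed.

End scheme_on_domain.

Theorem theorem4p1 (R : realType) (d : nat) (Omega : set 'rV[R]_d)
    (alpha gamma eps S T : R) (N : nat) (u : nat -> 'rV[R]_d -> R)
    (hd : (0 < d)%N)
    (hOmega : bounded_domain Omega)
    (hboundary : lipschitz_boundary Omega)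
    (halpha : 0 < alpha < 1) (hgamma : 0 < gamma) (heps : 0 < eps)
    (hT : 0 < T) (hN : (1 <= N)%N) (hS : 2 <= S)
    (hreg : forall n, (n <= N)%N ->
       sobolev Omega 2 (u n) /\ sobolev10 Omega (u n))
    (hu0 : (Linftynorm Omega (u 0%N) <= 1)%E)
    (hscheme : forall n, (1 <= n <= N)%N ->
       {ae lebesgue_rV d, forall x, Omega x ->
          L1deriv alpha (T / N%:R) u n x =
          gamma * (eps ^+ 2 * laplacian Omega (u n) x - f_dw (u n.-1 x)
                   - S * (u n x - u n.-1 x))}) :
  forall n, (1 <= n <= N)%N ->
    (modified_energy Omega alpha gamma eps (T / N%:R) u n <=
     modified_energy Omega alpha gamma eps (T / N%:R) u n.-1)%E.
Proof.
case: hOmega => _ /open_measurable_rV mOmega _ bOmega.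
have Omega_lty := bounded_lebesgue_rV_lty mOmega bOmega.
have u2 n (nN : (n <= N)%N) := (hreg n nN).1.
have u10 n (nN : (n <= N)%N) := (hreg n nN).2.
have u0_le1 := Linftynorm_le1 hu0.
have bound n (nN : (n <= N)%N) := discrete_maximum_bound mOmega Omega_lty halpha
  hgamma hS u2 u10 u0_le1 hscheme nN.
case=> [//|n] /andP[_ nN].
have nN' := ltnW nN.
rewrite (modified_energyE mOmega Omega_lty _ _ _ _
  (fun k kn => u2 k (leq_trans kn nN)) (u10 _ nN) (bound _ nN)).
rewrite (modified_energyE mOmega Omega_lty _ _ _ _
  (fun k kn => u2 k (leq_trans kn nN')) (u10 _ nN') (bound _ nN')).
rewrite lee_fin; exact: (real_energy_nonincreasing mOmega Omega_lty halpha
  hgamma hS u2 u10 u0_le1 hscheme nN).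
Qed.
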